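(* Let $n\ge 3$ and $p>n-1$. Let $f\colon B^n(0,1)\to\mathbb{R}^n$ be a (continuous) mapping of $p$-integrable distortion, and assume further that there are constants $c>0$ and $a\in[0,n-1-n/p)$ such that $$\int_{B(0,r)}J_f(x)\,dx\le c(1-r)^{-a}\qquad\text{for all } r\in(0,1).$$ Then $$\dim_{\mathcal{H}}E(f)\le a+\frac{n}{p},$$ where $\dim_{\mathcal{H}}$ denotes the Hausdorff dimension and $E(f)$ is the set of all points $x\in S^{n-1}(0,1)$ at which $f$ does not have a radial limit. In particular, $f$ has radial limits at almost every point of $\partial B^n(0,1)$.
   Context: $B(0,r)=B^n(0,r)$ is the open Euclidean ball and $S^{n-1}(0,1)=\partial B^n(0,1)$. Standing assumptions on $f\colon B^n(0,1)\to\mathbb{R}^n$: $f\in W^{1,1}_{\mathrm{loc}}(B^n(0,1),\mathbb{R}^n)$; the Jacobian determinant $J_f=\det Df$ is in $L^1_{\mathrm{loc}}(B^n(0,1))$; there is a measurable function $K(x)\ge 1$, finite almost everywhere, such that $$|Df(x)|^n\le K(x)J_f(x)\quad\text{for a.e. } x\in B^n(0,1);$$ and $$\frac{|Df(x)|^n}{\log(e+|Df(x)|)}\in L^1_{\mathrm{loc}}(B^n(0,1)).$$ Here $|Df(x)|$ is the operator norm. Such an $f$ is called a mapping of $p$-integrable distortion if there exists $M<\infty$ with $\int_{B^n(0,1)}K^p(x)\,dx\le M$. $f$ has a radial limit at $x\in S^{n-1}(0,1)$ if $\lim_{t\to1^-}f(tx)$ exists in $\mathbb{R}^n$. ''Almost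 every'' on $\partial B^n(0,1)$ is with respect to the $(n-1)$-dimensional surface measure. *)

(* Defs.v *)
(* Points of R^n are row vectors 'rV[R]_n. *)
From HB Require Import structures.
From mathcomp Require Import all_boot all_order all_algebra.
From mathcomp Require Import all_classical all_reals all_analysis measurable_realfun.

Set Implicit Arguments.
Unset Strict Implicit.
Unset Printing Implicit Defensive.
Import Order.TTheory GRing.Theory Num.Theory.
Import numFieldNormedType.Exports.
Local Open Scope classical_set_scope.
Local Open Scope ring_scope.

(* The library norm on 'rV[R]_n is the sup norm: it induces the right topology,
   but balls, diameters and operator norms below are Euclidean. *)
Definition enorm (R : realType) n (x : 'rV[R]_n) : R :=
  Num.sqrt (\sum_i x ord0 i ^+ 2).

Definition eball (R : realType) n (r : R) : set 'rV[R]_n :=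
  [set x | enorm x < r].

Definition esphere (R : realType) n : set 'rV[R]_n := [set x | enorm x = 1].

Definition opnorm (R : realType) n (A : 'M[R]_n) : R :=
  sup [set enorm (h *m A) | h in [set h | enorm h <= 1]].

(* Outer measure obtained from a weight w on sets by countable covers. *)
Definition cover_measure (R : realType) (T : Type) (w : set T -> \bar R)
    (A : set T) : \bar R :=
  ereal_inf [set (\sum_(k <oo) w (U k))%E |
             U in [set U : (set T)^nat | A `<=` \bigcup_k U k]].

Section cover_measure_theory.
Context (R : realType) (T : pointedType) (w : set T -> \bar R).
Local Open Scope ereal_scope.
Hypotheses (w0 : w set0 = 0) (w_ge0 : forall U, 0 <= w U).

Lemma cover_measureE :
  cover_measure w = @mu_ext _ (g_sigma_algebraType [set: set T]) R w.
Proof.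
apply/funext => A; rewrite /cover_measure /mu_ext; congr ereal_inf.
rewrite eqEsubset; split=> _ [U AU <-]; exists U => //; last by case: AU.
by split=> // i; exact: sub_sigma_algebra.
Qed.

Lemma cover_measure0 : cover_measure w set0 = 0.
Proof. by rewrite cover_measureE; exact: mu_ext0. Qed.

Lemma cover_measure_ge0 A : 0 <= cover_measure w A.
Proof. by rewrite cover_measureE; exact: mu_ext_ge0. Qed.

Lemma le_cover_measure :
  {homo cover_measure w : A B / A `<=` B >-> A <= B}.
Proof.
rewrite cover_measureE => A B.
exact: (@le_mu_ext _ (g_sigma_algebraType [set: set T]) R w).
Qed.

Lemma cover_measure_sigma_subadditive : sigma_subadditive (cover_measure w).
Proof.
rewrite cover_measureE.
exact: (@mu_ext_sigma_subadditive _ (g_sigma_algebraType [set: set T]) R w).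
Qed.

End cover_measure_theory.

Definition box (R : realType) n (a b : 'rV[R]_n) : set 'rV[R]_n :=
  [set x | forall i, a ord0 i <= x ord0 i <= b ord0 i].

(* The value is +oo when U is neither empty nor a box, so that only boxes and
   set0 are of use in covers; set0 is apart for the sake of n = 0. *)
Definition box_weight (R : realType) n (U : set 'rV[R]_n) : \bar R :=
  if U == set0 then 0%E
  else ereal_inf [set v | exists a b : 'rV[R]_n,
    [/\ forall i, a ord0 i <= b ord0 i, U = box a b &
        v = (\prod_i (b ord0 i - a ord0 i))%:E]].

Definition lebesgue_outer (R : realType) n : set 'rV[R]_n -> \bar R :=
  cover_measure (@box_weight R n).

Section lebesgue_rV.
Context (R : realType) (n : nat).

Lemma box_weight0 : box_weight (set0 : set 'rV[R]_n) = 0%E.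
Proof. by rewrite /box_weight eqxx. Qed.

Lemma box_weight_ge0 (U : set 'rV[R]_n) : (0 <= box_weight U)%E.
Proof.
rewrite /box_weight; case: ifP => // _.
apply: le_ereal_inf_tmp => _ [a [b [ab _ ->]]].
by rewrite lee_fin; apply: prodr_ge0 => i _; rewrite subr_ge0.
Qed.

HB.instance Definition _ := isOuterMeasure.Build R 'rV[R]_n
  (@lebesgue_outer R n)
  (cover_measure0 box_weight0 box_weight_ge0)
  (cover_measure_ge0 box_weight_ge0)
  (@le_cover_measure R 'rV[R]_n (@box_weight R n))
  (cover_measure_sigma_subadditive box_weight_ge0).

End lebesgue_rV.

Definition lebesgue_rV_display : measure_display.
Proof. exact: default_measure_display. Qed.

(* 'rV[R]_n carries the sigma-algebra of Lebesgue (Caratheodory) measurable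
   sets, not only the Borel sets. *)
HB.instance Definition _ (R : realType) n :=
  @isMeasurable.Build lebesgue_rV_display 'rV[R]_n
    (@lebesgue_outer R n).-caratheodory
    (@caratheodory_measurable_set0 R 'rV[R]_n (@lebesgue_outer R n))
    (@caratheodory_measurable_setC R 'rV[R]_n (@lebesgue_outer R n))
    (@caratheodory_measurable_bigcup R 'rV[R]_n (@lebesgue_outer R n)).

Definition lebesgue (R : realType) n : set 'rV[R]_n -> \bar R :=
  @lebesgue_outer R n.

HB.instance Definition _ (R : realType) n :=
  isMeasure.Build lebesgue_rV_display 'rV[R]_n R (@lebesgue R n)
    (@caratheodory_measure0 R 'rV[R]_n (@lebesgue_outer R n))
    (@caratheodory_measure_ge0 R 'rV[R]_n (@lebesgue_outer R n))
    (@caratheodory_measure_sigma_additive R 'rV[R]_n (@lebesgue_outer R n)).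

Definition ediam (R : realType) n (U : set 'rV[R]_n) : \bar R :=
  ereal_sup [set v | exists x y, [/\ U x, U y & v = (enorm (x - y))%:E]].

Definition hausdorff_weight (R : realType) n (s delta : R)
    (U : set 'rV[R]_n) : \bar R :=
  if U == set0 then 0%E
  else if (ediam U <= delta%:E)%E then poweR (ediam U) s else +oo%E.

Definition hausdorff_measure (R : realType) n (s : R) (A : set 'rV[R]_n)
    : \bar R :=
  ereal_sup [set cover_measure (@hausdorff_weight R n s delta) A |
             delta in [set delta : R | 0 < delta]].

Definition hausdorff_dim (R : realType) n (A : set 'rV[R]_n) : \bar R :=
  ereal_inf [set s%:E |
             s in [set s : R | 0 <= s /\ hausdorff_measure s A = 0%E]].

(* (n-1)-dimensional surface (outer) measure of subsets of R^n: with
   k = n.-1, the factor |B^k(0,1)| / 2^k turns the Hausdorff measure with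
   weights diam^k into the usual area. *)
Definition surface_measure (R : realType) n (A : set 'rV[R]_n) : \bar R :=
  (lebesgue_outer (@eball R n.-1 1) * (2 ^- n.-1)%:E
   * hausdorff_measure n.-1%:R A)%E.

Definition std_basis (R : realType) n (i : 'I_n) : 'rV[R]_n :=
  delta_mx ord0 i.

Definition iter_partial (R : realType) n (s : seq 'I_n) (phi : 'rV[R]_n -> R)
    : 'rV[R]_n -> R :=
  foldr (fun i g x => 'D_(std_basis R i) g x) phi s.

Definition smooth (R : realType) n (phi : 'rV[R]_n -> R) : Prop :=
  forall s : seq 'I_n, continuous (iter_partial s phi) /\
    forall i x, derivable (iter_partial s phi) x (std_basis R i).

Definition test_function (R : realType) n (D : set 'rV[R]_n)
    (phi : 'rV[R]_n -> R) : Prop :=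
  let supp := closure [set x | phi x != 0] in
  [/\ smooth phi, compact supp & supp `<=` D].

Definition L1loc (R : realType) n (D : set 'rV[R]_n) (u : 'rV[R]_n -> R)
    : Prop :=
  measurable_fun D u /\
  forall C, C `<=` D -> compact C ->
    (\int[@lebesgue R n]_(x in C) `|u x|%:E < +oo)%E.

Definition weak_partial (R : realType) n (D : set 'rV[R]_n) (i : 'I_n)
    (u g : 'rV[R]_n -> R) : Prop :=
  forall phi, test_function D phi ->
    (\int[@lebesgue R n]_(x in D) (u x * 'D_(std_basis R i) phi x)%:E =
     - \int[@lebesgue R n]_(x in D) (g x * phi x)%:E)%E.

(* f is in W^{1,1}_loc(D, R^n) with weak differential Df. As for the library's
   'J, the differential at x is h |-> h *m Df x, so Df x i j is the i-th
   partial derivative of the j-th component. *)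
Definition W11loc (R : realType) n (D : set 'rV[R]_n)
    (f : 'rV[R]_n -> 'rV[R]_n) (Df : 'rV[R]_n -> 'M[R]_n) : Prop :=
  forall j, L1loc D (fun x => f x ord0 j) /\
    forall i, L1loc D (fun x => Df x i j) /\
      weak_partial D i (fun x => f x ord0 j) (fun x => Df x i j).

(* Jacobian determinant; the library has jacobian for the matrix of a classical
   differential. *)
Definition jac (R : realType) n (Df : 'rV[R]_n -> 'M[R]_n)
    (x : 'rV[R]_n) : R := \det (Df x).

Record finite_distortion (R : realType) n (f : 'rV[R]_n -> 'rV[R]_n)
    (Df : 'rV[R]_n -> 'M[R]_n) (K : 'rV[R]_n -> \bar R) : Prop := {
  fd_sobolev : W11loc (@eball R n 1) f Df ;
  fd_jacobian : L1loc (@eball R n 1) (jac Df) ;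
  fd_K_measurable : measurable_fun (@eball R n 1) K ;
  fd_K_ge1 : forall x, eball 1 x -> (1 <= K x)%E ;
  fd_K_fin : {ae @lebesgue R n, forall x, eball 1 x -> (K x < +oo)%E} ;
  fd_distortion : {ae @lebesgue R n, forall x, eball 1 x ->
    ((opnorm (Df x) ^+ n)%:E <= K x * (jac Df x)%:E)%E} ;
  fd_log_integrable : L1loc (@eball R n 1)
    (fun x => opnorm (Df x) ^+ n / ln (expR 1 + opnorm (Df x)))
}.

Definition p_integrable_distortion (R : realType) n (p : R)
    (f : 'rV[R]_n -> 'rV[R]_n) (Df : 'rV[R]_n -> 'M[R]_n)
    (K : 'rV[R]_n -> \bar R) : Prop :=
  finite_distortion f Df K /\
  exists M : R,
    (\int[@lebesgue R n]_(x in eball 1%R) poweR (K x) p <= M%:E)%E.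

Definition has_radial_limit (R : realType) n (f : 'rV[R]_n -> 'rV[R]_n)
    (x : 'rV[R]_n) : Prop :=
  exists l : 'rV[R]_n, f (t *: x) @[t --> (1 : R)^'-] --> l.

Definition radial_exceptional_set (R : realType) n
    (f : 'rV[R]_n -> 'rV[R]_n) : set 'rV[R]_n :=
  [set x | esphere x /\ ~ has_radial_limit f x].

(* Main.v *)
(* No monotonicity of f is needed. Averages of a component u of f against
   product bump functions at comparable scales r differ by at most a multiple of
   r^(1-n) times the integral of |Df| over a cube of side ~ r, since the
   difference of two such product kernels is a sum of partial derivatives of
   test functions. Splitting |Df|^n <= K J pointwise as
   |Df| <= A K^p + C + A^(-1/p) C^(-(n-1-1/p)) J and choosing A = r^(n-1+d),
   C = r^(d-1), this quantity is O(r^d) as soon as the integral of J over the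
   cube is at most r^(n/p + n d). So u(tx) converges geometrically along the
   radius unless infinitely many scales r_m = eps lam^m have a heavy cube,
   centred at a point of the radius at distance ~ r_m from the sphere. At scale
   r_m, disjoint heavy cubes number at most c r_m^(-a) / r_m^(n/p + n d), so the
   bad directions are covered by that many sets of diameter ~ r_m, and
   sum_m r_m^(s - a - n/p - n d) < +oo when s > a + n/p + n d. *)
Require Import Defs.
From HB Require Import structures.
From mathcomp Require Import all_boot all_order all_algebra.
From mathcomp Require Import all_classical all_reals all_analysis measurable_realfun.
From mathcomp Require Import ring lra.
Import Order.TTheory GRing.Theory Num.Theory.
Import numFieldNormedType.Exports.
Set Implicit Arguments.
Unset Strict Implicit.
Unset Printing Implicit Defensive.
Local Open Scope classical_set_scope.
Local Open Scope ring_scope.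

(** * Smooth functions of one real variable and a compactly supported bump *)

Section smooth_real_functions.
Context {R : realType}.
Implicit Types (f g : R -> R) (k : nat) (x t : R).

(** Averages are tied to point values by continuity only: at a fixed point, averages over shrinking
    scales tend to a fixed positive multiple of [u]. Every scale finer than the starting one is
    therefore used at each point of the radius, and a good direction must have light cubes of scale
    r_m about all its points from radius 1/2 up to distance of order r_m from the sphere.

    A difference of two kernels is a partial derivative of a function with compact support because
    one-variable kernels of all centres and scales have the same mass: their primitives vanish far
    to the left and share one plateau far to the right.

    Product kernels lead to cubes and to the sup norm, whereas the balls, the sphere and the
    dimension are Euclidean. The price is a factor n at each passage, and it accounts for the n in
    eps = 1/(8n) and in the diameters of the covering sets.

    The number d > 0 is a free loss: it makes the changes of the averages summable and costs n d in
    the dimension. It is chosen for each s > a + n/p separately. *)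

Fixpoint Ck k f : Prop :=
  if k is k'.+1 then
    exists f', (forall x, is_derive x (1 : R) f (f' x)) /\ Ck k' f'
  else True.

(** Derivatives are existential witnesses in [Ck], so that closure under sums, products and
    composition is an induction on the order. *)
Definition smooth1 f := forall k, Ck k f.

Lemma CkW k f : Ck k.+1 f -> Ck k f.
Proof.
elim: k f => [//|k IH] f [f' [df Cf']].
by exists f'; split => //; exact: IH.
Qed.

Lemma Ck_cst k (c : R) : Ck k (cst c).
Proof.
elim: k c => [//|k IH] c /=; exists (cst 0); split; last exact: IH.
by move=> x; exact: is_derive_cst.
Qed.

Lemma is_derive_affine (a b x : R) : is_derive x (1 : R) (fun t => a * t + b) a.
Proof.
have -> : (fun t => a * t + b) = (a \*: (@id R)) + cst b by apply/funext.
by apply: is_derive_eq; rewrite addr0 [_ *: _]mulr1.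
Qed.

Lemma Ck_affine k (a b : R) : Ck k (fun t => a * t + b).
Proof.
case: k => [//|k] /=; exists (cst a); split; last exact: Ck_cst.
by move=> x; exact: is_derive_affine.
Qed.

Lemma CkD k f g : Ck k f -> Ck k g -> Ck k (f + g).
Proof.
elim: k f g => [//|k IH] f g [f' [df Cf]] [g' [dg Cg]].
by exists (f' + g'); split; [move=> x; exact: is_deriveD|exact: IH].
Qed.

Lemma CkM k f g : Ck k f -> Ck k g -> Ck k (f * g).
Proof.
elim: k f g => [//|k IH] f g Cf Cg.
move: (Cf) (Cg) => [f' [df Cf']] [g' [dg Cg']].
exists (f * g' + g * f'); split; first by move=> x; exact: is_deriveM.
by apply: CkD; apply: IH => //; exact: CkW.
Qed.

Lemma Ck_comp k f g : Ck k f -> Ck k g -> Ck k (f \o g).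
Proof.
elim: k f g => [//|k IH] f g Cf Cg.
move: (Cf) (Cg) => [f' [df Cf']] [g' [dg Cg']].
exists ((f' \o g) * g'); split; first by move=> x; exact: is_derive1_comp.
by apply: CkM => //; apply: IH => //; exact: CkW.
Qed.

(** By uniqueness of the derivative, [f'] is the witness contained in [Ck k.+1 f]. *)
Lemma smooth1_derive f f' : smooth1 f ->
  (forall x, is_derive x (1 : R) f (f' x)) -> smooth1 f'.
Proof.
move=> sf df k; have [f'' [df2 Cf'']] := sf k.+1.
suff -> : f' = f'' by [].
by apply/funext => x; rewrite -(@derive_val _ _ _ _ _ _ _ (df x)) derive_val.
Qed.

Lemma smooth1_ex f : smooth1 f ->
  exists f', (forall x, is_derive x (1 : R) f (f' x)) /\ smooth1 f'.
Proof.
move=> sf; have [f' [df _]] := sf 1%N.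
by exists f'; split => //; exact: smooth1_derive df.
Qed.

Lemma smooth1_continuous f : smooth1 f -> continuous f.
Proof.
move=> /smooth1_ex[f' [df _]] x.
by apply/differentiable_continuous/derivable1_diffP.
Qed.

(** The classical flat function is [flat 0]. The negative powers make the span of the family stable
    under differentiation, which gives all orders by one induction. *)
Definition flat k t : R := if 0 < t then t ^- k * expR (- t^-1) else 0.

Lemma flat_le0 k t : t <= 0 -> flat k t = 0.
Proof. by rewrite /flat => t0; rewrite ltNge t0. Qed.

Lemma flat_gt0 k t : 0 < t -> 0 < flat k t.
Proof.
by move=> t0; rewrite /flat t0 mulr_gt0 ?expR_gt0// invr_gt0 exprn_gt0.
Qed.

Lemma flat_ge0 k t : 0 <= flat k t.
Proof. by have [/flat_le0->//|/(flat_gt0 k)/ltW] := leP t 0. Qed.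

(** The exponential series of 1/t dominates its term of order k + 2. This serves to show that the
    functions [flat k] tend to 0 at 0. *)
Lemma flat_le_sqr k t : flat k t <= k.+2`!%:R * t ^+ 2.
Proof.
have [t0|t0] := leP t 0; first by rewrite flat_le0// mulr_ge0 ?sqr_ge0.
rewrite /flat t0 expRN ler_pdivrMr ?expR_gt0//.
rewrite -[t ^- k]mul1r ler_pdivrMr ?exprn_gt0//.
have := @expR_ge1Dxn R t^-1 k.+1; rewrite invr_ge0 => /(_ (ltW t0)) H.
have {}H : t^-1 ^+ k.+2 / k.+2`!%:R <= expR t^-1.
  by apply: le_trans H; rewrite lerDr.
move: H; rewrite ler_pdivrMr ?ltr0n ?fact_gt0// exprVn -[_ ^- _]mul1r.
rewrite ler_pdivrMr ?exprn_gt0// => H.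
apply: le_trans H _; rewrite -addn2 exprD.
by rewrite le_eqVlt; apply/orP; left; apply/eqP; ring.
Qed.

Lemma is_derive_flat k x :
  is_derive x (1 : R) (flat k) (- k%:R * flat k.+1 x + flat k.+2 x).
Proof.
have [x0|x0|x0] := ltgtP x 0.
- have -> : - k%:R * flat k.+1 x + flat k.+2 x = 0.
    by rewrite !flat_le0 ?ltW// mulr0 addr0.
  apply: (@near_eq_is_derive _ _ _ (cst 0)) => //.
  by near=> t; rewrite flat_le0// ltW//; near: t; exact: lt_nbhsl.
- apply: (@near_eq_is_derive _ _ _ (fun t => t^-1 ^+ k * expR (- t^-1))).
  + near=> t; rewrite /flat ifT ?exprVn//; near: t.
    exact: lt_nbhsr.
  + have xneq0 : x != 0 by rewrite gt_eqF.
    have dV : is_derive x (1 : R) (fun y : R => y^-1) (- x ^- 2 *: 1).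
      exact: (@is_deriveV _ id).
    have dX := @is_deriveX _ _ _ k _ _ _ dV.
    have dE := @is_derive1_comp _ expR (- (fun t : R => t^-1)) x _ _
       (is_derive_expR _) (is_deriveN dV).
    have := is_deriveM dX dE.
    set F := (X in is_derive _ _ X _); move=> H.
    have -> : (fun t => t^-1 ^+ k * expR (- t^-1)) = F.
      by apply/funext => t; rewrite /F !fctE.
    apply: is_derive_eq H _; rewrite /flat x0 /= !fctE /=.
    rewrite /GRing.scale /=.
    clear F dX; case: k => [|k] /=; first by field.
    rewrite !exprVn !exprS !invfM; set y := x ^+ k; field.
    by rewrite xneq0 expf_neq0.
- rewrite x0 !flat_le0 ?mulr0 ?addr0//.
  (* The difference quotient of [flat k] at 0 is exactly [flat k.+1], so that continuity of the
     latter at 0 is all that has to be shown. *)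
  apply/is_derive1_caratheodory; exists (flat k.+1); split; last first.
  + by rewrite flat_le0.
  + apply/cvgrPdist_lt => e e0 /=.
    rewrite flat_le0//; near=> t; rewrite sub0r normrN ger0_norm ?flat_ge0//.
    apply: le_lt_trans (flat_le_sqr _ _) _.
    have M0 : 0 < (k.+3)`!%:R :> R by rewrite ltr0n fact_gt0.
    have t1 : `|t| < 1.
      by near: t; exact: (@pseudometric_normed_Zmodule.nbhs0_lt _ R).
    apply: (@le_lt_trans _ _ (k.+3`!%:R * `|t|)).
      rewrite ler_pM2l// -real_normK ?num_real// expr2 -[leRHS]mulr1 ler_wpM2l//.
    rewrite mulrC -ltr_pdivlMr//; near: t.
    apply: (@pseudometric_normed_Zmodule.nbhs0_lt _ R).
    by rewrite divr_gt0.
  + move=> z; rewrite subr0 (flat_le0 _ (lexx 0)) subr0.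
    have [z0|z0] := leP z 0; first by rewrite !flat_le0// mul0r.
    rewrite /flat z0 exprS; set y := z ^+ k; field.
    by rewrite expf_neq0 gt_eqF.
Unshelve. all: by end_near. Qed.

Lemma smooth1_flat k : smooth1 (flat k).
Proof.
move=> j; elim: j k => [//|j IH] k.
exists (cst (- k%:R) * flat k.+1 + flat k.+2); split.
  exact: is_derive_flat.
by apply: CkD => //; apply: CkM => //; exact: Ck_cst.
Qed.

Lemma flat0_lt s t : 0 < s -> s < t -> flat 0 s < flat 0 t.
Proof.
move=> s0 st; rewrite /flat s0 (lt_trans s0 st) !expr0 invr1 !mul1r.
by rewrite ltr_expR ltrN2 ltf_pV2// posrE// (lt_trans s0).
Qed.

Lemma flat0_le1 t : flat 0 t <= 1.
Proof.
rewrite /flat; case: ifPn => // t0; rewrite expr0 invr1 mul1r.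
by rewrite -(expR0 R) ler_expR oppr_le0 invr_ge0 ltW.
Qed.

(* The outer argument is [<= 0] when [t <= -1], and the inner [flat] vanishes
   when [t >= 1], so that [step] is constant outside [-1, 1]. *)
Definition step t : R := flat 0 (flat 0 2 - flat 0 (1 - t)).

(** The chain rule applied to [step], with [flat 2] as the derivative of [flat 0]. Sign and support
    can be read off from this closed form. *)
Definition bump t : R := flat 2 (flat 0 2 - flat 0 (1 - t)) * flat 2 (1 - t).

Lemma is_derive_step x : is_derive x (1 : R) step (bump x).
Proof.
have dflat0 y : is_derive y (1 : R) (flat 0) (flat 2 y).
  by apply: is_derive_eq (is_derive_flat 0 y) _; rewrite oppr0 mul0r add0r.
have d1 : is_derive x (1 : R) (fun t => 1 - t) (-1).
  have -> : (fun t => 1 - t) = cst 1 - id by apply/funext.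
  by apply: is_derive_eq; rewrite sub0r.
have d2 := @is_derive1_comp _ (flat 0) (fun t => 1 - t) x _ _ (dflat0 (1 - x)) d1.
have d3 := is_deriveB (is_derive_cst (flat 0 2) x (1 : R)) d2.
have d4 := @is_derive1_comp _ (flat 0)
  (cst (flat 0 2) - (flat 0 \o (fun t => 1 - t))) x _ _ (dflat0 _) d3.
apply: is_derive_eq d4 _.
by rewrite /bump !fctE /= mulrN1 sub0r opprK.
Qed.

Lemma smooth1_step : smooth1 step.
Proof.
have s1 : smooth1 (fun t => 1 - t).
  move=> k; have := Ck_affine k (-1) 1.
  by congr Ck; apply/funext => t; rewrite mulN1r addrC.
move=> k; apply: (@Ck_comp _ (flat 0) (fun t => flat 0 2 - flat 0 (1 - t))).
  exact: smooth1_flat.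
have -> : (fun t => flat 0 2 - flat 0 (1 - t)) =
    (fun t => (-1) * t + flat 0 2) \o (flat 0 \o (fun t => 1 - t)).
  by apply/funext => t /=; rewrite mulN1r addrC.
apply: Ck_comp; first exact: Ck_affine.
by apply: Ck_comp => //; exact: smooth1_flat.
Qed.

Lemma smooth1_bump : smooth1 bump.
Proof. exact: smooth1_derive smooth1_step is_derive_step. Qed.

Lemma flat0_2B_le0 t : t <= -1 -> flat 0 2 - flat 0 (1 - t) <= 0.
Proof.
move=> t1; rewrite subr_le0; have [->|tN1] := eqVneq t (-1).
  by have -> : 1 - (-1) = 2 :> R by ring.
by apply/ltW/flat0_lt => //; lra.
Qed.

Lemma step_le t : t <= -1 -> step t = 0.
Proof. by move=> t1; rewrite /step flat_le0// flat0_2B_le0. Qed.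

Lemma step_ge t : 1 <= t -> step t = step 1.
Proof.
by move=> t1; rewrite /step subrr (flat_le0 _ (lexx 0)) (@flat_le0 _ (1 - t))// subr_le0.
Qed.

Lemma step_ge0 t : 0 <= step t. Proof. exact: flat_ge0. Qed.

Lemma step_le1 t : step t <= 1. Proof. exact: flat0_le1. Qed.

Lemma bump_ge0 t : 0 <= bump t.
Proof. by rewrite mulr_ge0// flat_ge0. Qed.

Lemma bump_out t : 1 <= `|t| -> bump t = 0.
Proof.
rewrite /bump ler_normr => /orP[t1|t1].
  by rewrite (@flat_le0 2 (1 - t)) ?mulr0// subr_le0.
by rewrite flat_le0 ?mul0r// flat0_2B_le0// lerNr.
Qed.

Lemma bump_gt0 t : `|t| < 1 -> 0 < bump t.
Proof.
rewrite ltr_norml => /andP[t1 t2]; rewrite mulr_gt0// flat_gt0 ?subr_gt0//.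
by apply: flat0_lt; lra.
Qed.

Lemma bump_bounded : exists2 M, 1 <= M & forall t, bump t <= M.
Proof.
have c : {within `[-1, 1], continuous bump}.
  by apply: continuous_subspaceT; exact/smooth1_continuous/smooth1_bump.
have [c0 _ Hc] := @EVT_max R bump (-1) 1 ltac:(lra) c.
exists (bump c0 + 1); first by rewrite lerDr bump_ge0.
move=> t; have [t1|t1] := leP 1 `|t|.
  by rewrite bump_out// addr_ge0// bump_ge0.
rewrite (le_trans (Hc t _)) ?lerDl// in_itv/=.
by move: t1; rewrite ltr_norml => /andP[/ltW -> /ltW ->].
Qed.

Lemma bump_ge : exists2 e, 0 < e & forall t, `|t| <= 2^-1 -> e <= bump t.
Proof.
have c : {within `[-2^-1, 2^-1], continuous bump}.
  by apply: continuous_subspaceT; exact/smooth1_continuous/smooth1_bump.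
have [c0 c0i Hc] := @EVT_min R bump (-2^-1) (2^-1) ltac:(lra) c.
exists (bump c0); last first.
  by move=> t th; apply: Hc; rewrite in_itv/= -ler_norml.
apply: bump_gt0; apply: le_lt_trans (_ : 2^-1 < 1); last by lra.
by move: c0i; rewrite in_itv/= -ler_norml.
Qed.

End smooth_real_functions.

(** * Test functions that are products of functions of one coordinate *)

Section product_test_functions.
Context {R : realType} {n : nat}.
Implicit Types (psi : 'I_n -> R -> R) (x y : 'rV[R]_n) (i j : 'I_n).

Definition prodf psi y : R := \prod_i psi i (y ord0 i).

Definition upd (T : Type) (c : 'I_n -> T) i (a : T) : 'I_n -> T :=
  fun j => if j == i then a else c j.

Lemma updE (T : Type) (c : 'I_n -> T) i a : upd c i a i = a.
Proof. by rewrite /upd eqxx. Qed.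

Lemma prodf_upd psi i g y :
  prodf (upd psi i g) y = g (y ord0 i) * \prod_(j | j != i) psi j (y ord0 j).
Proof.
rewrite /prodf (bigD1 i)//= updE; congr (_ * _).
by apply: eq_bigr => j /negPf ji; rewrite /upd ji.
Qed.

Lemma upd_id (T : Type) (c : 'I_n -> T) i : upd c i (c i) = c.
Proof. by apply/funext => j; rewrite /upd; case: eqP => [->|]. Qed.

Lemma is_derive_prodf psi i g y :
  (forall t, is_derive t (1 : R) (psi i) (g t)) ->
  is_derive y (std_basis R i) (prodf psi) (prodf (upd psi i g) y).
Proof.
move=> dpsi; pose c := \prod_(j | j != i) psi j (y ord0 j).
have H : h^-1 *: ((prodf psi \o shift y) (h *: std_basis R i) - prodf psi y)
    @[h --> 0^'] --> prodf (upd psi i g) y.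
  have -> : (fun h => h^-1 *: ((prodf psi \o shift y) (h *: std_basis R i)
                        - prodf psi y)) =
      (fun h => (h^-1 *: ((psi i \o shift (y ord0 i)) (h *: 1) -
         psi i (y ord0 i))) * c).
    apply/funext => h /=; rewrite /GRing.scale /= -mulrA; congr (_ * _).
    rewrite -{2}(upd_id psi i) prodf_upd -/c mulrBl; congr (_ - _).
    rewrite /prodf (bigD1 i)//= !mxE; congr (_ * _).
      by rewrite !eqxx.
    by apply: eq_bigr => j ji; rewrite !mxE (negPf ji) andbF mulr0 add0r.
  rewrite prodf_upd -/c; apply: cvgMl.
  have [H1 <-] := dpsi (y ord0 i).
  exact: H1.
apply: DeriveDef; first by apply/cvg_ex; eexists; exact: H.
exact: cvg_lim H.
Qed.

Lemma continuous_prodf psi : (forall i, continuous (psi i)) ->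
  continuous (prodf psi).
Proof.
move=> cpsi x; rewrite /prodf.
elim: (index_enum _) => [|i s IH].
  rewrite (_ : (fun y => _) = cst 1); first exact: cst_continuous.
  by apply/funext => y; rewrite big_nil.
rewrite (_ : (fun y => _) = (fun y : 'rV[R]_n => psi i (y ord0 i) *
  \prod_(j <- s) psi j (y ord0 j))); last first.
  by apply/funext => y; rewrite big_cons.
have c1 : {for x, continuous (fun y : 'rV[R]_n => psi i (y ord0 i))}.
  apply: (@continuous_comp _ _ _ (fun z : 'rV[R]_n => z ord0 i) (psi i)).
    exact: coord_continuous.
  exact: cpsi.
exact: (cvgM c1 IH).
Qed.

(** A partial derivative only replaces one factor by its derivative, so the class of such products
    is stable. *)
Lemma iter_partial_prodf s psi : (forall i, smooth1 (psi i)) ->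
  exists psi', (forall i, smooth1 (psi' i)) /\
    iter_partial s (prodf psi) = prodf psi'.
Proof.
move=> spsi; elim: s => [|i s [psi' [spsi' IH]]]; first by exists psi.
rewrite -[iter_partial _ _]/
  (fun x => 'D_(std_basis R i) (iter_partial s (prodf psi)) x) IH.
have [g [dg sg]] := smooth1_ex (spsi' i).
exists (upd psi' i g); split.
  by move=> j; rewrite /upd; case: ifP.
apply/funext => x; have := is_derive_prodf x dg.
by move=> ?; rewrite derive_val.
Qed.

Lemma smooth_prodf psi : (forall i, smooth1 (psi i)) -> smooth (prodf psi).
Proof.
move=> spsi s; have [psi' [spsi' ->]] := iter_partial_prodf s spsi; split.
  by apply: continuous_prodf => i; exact: smooth1_continuous.
move=> i x; have [g [dg _]] := smooth1_ex (spsi' i).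
by have [] := is_derive_prodf x dg.
Qed.

Lemma closed_box (a b : 'rV[R]_n) : closed (box a b).
Proof.
have -> : box a b = \bigcap_(i in [set: 'I_n])
    ((fun x : 'rV[R]_n => x ord0 i) @^-1` `[a ord0 i, b ord0 i]%classic).
  apply/seteqP; split => x /=.
    by move=> H i _ /=; rewrite in_itv /=; exact: H.
  by move=> H i; have := H i I; rewrite /= in_itv.
apply: closed_bigI => i _; apply: preimage_closed.
  by move=> x _; exact: coord_continuous.
exact: itv_closed.
Qed.

Lemma compact_box (a b : 'rV[R]_n) : compact (box a b).
Proof.
have := @rV_compact R n (fun i => `[a ord0 i, b ord0 i]%classic)
  (fun i => @segment_compact R _ _).
by congr compact; apply/seteqP; split => x /= H i.
Qed.

Lemma test_function_prodf (D : set 'rV[R]_n) psi (a b : 'rV[R]_n) :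
  (forall i, smooth1 (psi i)) ->
  (forall i t, ~~ (a ord0 i <= t <= b ord0 i) -> psi i t = 0) ->
  box a b `<=` D -> test_function D (prodf psi).
Proof.
move=> spsi psi0 abD.
have S : closure [set x | prodf psi x != 0] `<=` box a b.
  rewrite [X in _ `<=` X](closure_id _).1; last exact: closed_box.
  apply: closure_subset => x /= px i; apply: contraNT px => /psi0 pi0.
  by rewrite /prodf (bigD1 i)//= pi0 mul0r.
split; first exact: smooth_prodf.
  by apply: subclosed_compact S; [exact: closed_closure|exact: compact_box].
exact: subset_trans S abD.
Qed.

End product_test_functions.

(** * Measurability of half-spaces, boxes and open sets *)

Section lebesgue_boxes.
Context {R : realType} {n : nat}.
Implicit Types (a b x y : 'rV[R]_n) (i j : 'I_n) (t : R) (U : set 'rV[R]_n).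
Local Open Scope ereal_scope.

Lemma box_ne a b : (forall i, a ord0 i <= b ord0 i)%R -> box a b !=set0.
Proof. by move=> ab; exists a => i; rewrite lexx ab. Qed.

Lemma box_weight_le a b : (forall i, a ord0 i <= b ord0 i)%R ->
  box_weight (box a b) <= (\prod_i (b ord0 i - a ord0 i))%:E.
Proof.
move=> ab; rewrite /box_weight ifF; last first.
  by apply/negbTE/set0P; exact: box_ne.
by apply: ereal_inf_lbound; exists a, b.
Qed.

Lemma lebesgue_box_le a b : (forall i, a ord0 i <= b ord0 i)%R ->
  lebesgue_outer (box a b) <= (\prod_i (b ord0 i - a ord0 i))%:E.
Proof.
move=> ab; apply: le_trans (box_weight_le ab).
apply: ereal_inf_lbound; exists (fun k => if k == 0%N then box a b else set0).
  by move=> x abx; exists 0%N.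
rewrite (nneseries_split 0%N 1%N)//; last first.
  by move=> k _; case: ifP => *; exact: box_weight_ge0.
rewrite add0n big_nat1 eseries0 ?adde0//.
by move=> [|k]//= _ _; exact: box_weight0.
Qed.

Definition setc a i t : 'rV[R]_n := \row_j (if j == i then t else a ord0 j).

Lemma prod_setc (F : 'I_n -> R -> R) a i t :
  (\prod_j F j (setc a i t ord0 j) = F i t * \prod_(j | j != i) F j (a ord0 j))%R.
Proof.
rewrite (bigD1 i)//= mxE eqxx; congr (_ * _)%R.
by apply: eq_bigr => j /negPf ji; rewrite mxE ji.
Qed.

(** The splitting condition of Caratheodory for one covering set. Both closed halves of a box are
    boxes again, and the hyperplane that they share adds nothing to the product of the side
    lengths. *)
Lemma box_weight_half U i t :
  box_weight (U `&` [set x | x ord0 i <= t]%R) +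
  box_weight (U `&` [set x | t <= x ord0 i]%R) <= box_weight U.
Proof.
have [->|U0] := eqVneq U set0; first by rewrite !set0I !box_weight0 adde0.
rewrite [leRHS]/box_weight (negbTE U0); apply: le_ereal_inf_tmp.
move=> _ [a [b [ab -> ->]]].
have [tai|ait] := ltP t (a ord0 i).
  rewrite (_ : _ `&` _ = set0); last first.
    apply/seteqP; split => x //= [/(_ i)/andP[ax _] xt].
    by have := lt_le_trans tai (le_trans ax xt); rewrite ltxx.
  rewrite box_weight0 add0e (_ : _ `&` _ = box a b); first exact: box_weight_le.
  apply: setIidl => x /(_ i)/andP[ax _] /=.
  by rewrite (le_trans (ltW tai)).
have [bit|tbi] := ltP (b ord0 i) t.
  rewrite [X in _ + box_weight X](_ : _ `&` _ = set0); last first.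
    apply/seteqP; split => x //= [/(_ i)/andP[_ xb] xt].
    by have := lt_le_trans bit (le_trans xt xb); rewrite ltxx.
  rewrite box_weight0 adde0 (_ : _ `&` _ = box a b); first exact: box_weight_le.
  apply: setIidl => x /(_ i)/andP[_ xb] /=.
  by rewrite (le_trans _ (ltW bit)).
have -> : box a b `&` [set x | x ord0 i <= t]%R = box a (setc b i t).
  apply/seteqP; split => x /=.
    move=> [abx xt] j; rewrite mxE; case: eqP => [->|_]; last exact: abx.
    by rewrite xt andbT; have /andP[] := abx i.
  move=> H; split; last by have := H i; rewrite mxE eqxx => /andP[].
  move=> j; have := H j; rewrite mxE; case: eqP => [->|_//].
  by move=> /andP[-> /=] /le_trans; apply.
have -> : box a b `&` [set x | t <= x ord0 i]%R = box (setc a i t) b.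
  apply/seteqP; split => x /=.
    move=> [abx xt] j; rewrite mxE; case: eqP => [->|_]; last exact: abx.
    by rewrite xt; have /andP[] := abx i.
  move=> H; split; last by have := H i; rewrite mxE eqxx => /andP[].
  move=> j; have := H j; rewrite mxE; case: eqP => [->|_//].
  by move=> /andP[/(le_trans ait) -> ->].
apply: le_trans (leeD (box_weight_le _) (box_weight_le _)) _.
- by move=> j; rewrite mxE; case: eqP => [->|].
- by move=> j; rewrite mxE; case: eqP => [->|].
rewrite -EFinD lee_fin (prod_setc (fun j s => s - a ord0 j)%R).
rewrite (prod_setc (fun j s => b ord0 j - s)%R) [leRHS](bigD1 i)//= -mulrDl.
by rewrite addrC addrA subrK.
Qed.

Lemma measurable_halfspace i t :
  measurable ([set x | x ord0 i <= t]%R : set 'rV[R]_n).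
Proof.
apply: (@le_caratheodory_measurable _ _ (@lebesgue_outer R n)) => X.
apply: le_ereal_inf_tmp => _ [U XU <-].
pose V k := U k `&` [set x | x ord0 i <= t]%R.
pose W k := U k `&` [set x | t <= x ord0 i]%R.
have V1 : lebesgue_outer (X `&` [set x | x ord0 i <= t]%R) <=
    \sum_(k <oo) box_weight (V k).
  apply: ereal_inf_lbound; exists V => // x [/XU [k _ Ux] xt].
  by exists k.
have W1 : lebesgue_outer (X `&` ~` [set x | x ord0 i <= t]%R) <=
    \sum_(k <oo) box_weight (W k).
  apply: ereal_inf_lbound; exists W => // x [/XU [k _ Ux] /negP xt].
  by exists k => //; split => //=; rewrite ltW// ltNge.
apply: le_trans (leeD V1 W1) _.
rewrite -nneseriesD; try by move=> *; exact: box_weight_ge0.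
apply: lee_nneseries => [k _ _|k _]; last exact: box_weight_half.
by rewrite adde_ge0// box_weight_ge0.
Qed.

Lemma measurable_coord i :
  measurable_fun [set: 'rV[R]_n] (fun x : 'rV[R]_n => x ord0 i).
Proof.
apply: (measurability _ (RGenOInfty.measurableE R)).
move=> _ [_ [t ->] <-]; rewrite setTI.
have -> : (fun x : 'rV[R]_n => x ord0 i) @^-1` `]t, +oo[%classic =
    ~` ([set x | x ord0 i <= t]%R : set 'rV[R]_n); last exact/measurableC/measurable_halfspace.
by apply/seteqP; split => x /=; rewrite in_itv/= andbT ltNge => /negP.
Qed.

Lemma measurable_box a b : measurable (box a b : set 'rV[R]_n).
Proof.
have -> : box a b = \bigcap_(i in [set: 'I_n])
    ((fun x : 'rV[R]_n => x ord0 i) @^-1` `[a ord0 i, b ord0 i]%classic).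
  apply/seteqP; split => x /=.
    by move=> H i _ /=; rewrite in_itv /=; exact: H.
  by move=> H i; have := H i Logic.I; rewrite /= in_itv.
apply: fin_bigcap_measurable => // i _.
by rewrite -[X in measurable X]setTI; exact: measurable_coord.
Qed.

Lemma open_measurable_rV U : open U -> measurable U.
Proof.
move=> oU; pose Q := ('rV[rat]_n * 'rV[rat]_n)%type.
pose B (q : Q) : set 'rV[R]_n := box (map_mx ratr q.1) (map_mx ratr q.2).
have -> : U = \bigcup_(q in [set: Q]) (if `[< B q `<=` U >] then B q else set0).
  apply/seteqP; split => [x Ux|x [q _]]; last first.
    by case: ifPn => // /asboolP; exact.
  have /nbhs_ballP[e /= e0 xeU] := oU x Ux.
  have ex1 i : exists q : rat, (x ord0 i - e < ratr q < x ord0 i)%R.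
    have [q] := @rat_in_itvoo R (x ord0 i - e) (x ord0 i)%R ltac:(rewrite ltrBlDr ltrDl//).
    by rewrite in_itv/= => ?; exists q.
  have ex2 i : exists q : rat, (x ord0 i < ratr q < x ord0 i + e)%R.
    have [q] := @rat_in_itvoo R (x ord0 i) (x ord0 i + e)%R ltac:(rewrite ltrDl//).
    by rewrite in_itv/= => ?; exists q.
  have [f1 Hf1] := choice ex1; have [f2 Hf2] := choice ex2.
  exists (\row_i f1 i, \row_i f2 i) => //=.
  rewrite ifT.
    move=> i; rewrite !mxE.
    by have /andP[_ /ltW ->] := Hf1 i; have /andP[/ltW -> _] := Hf2 i.
  apply/asboolP => y By; apply: xeU; split => // i' i; rewrite ord1.
  have := By i; rewrite !mxE /= => /andP[y1 y2].
  have /andP[h1 h2] := Hf1 i; have /andP[h3 h4] := Hf2 i.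
  by rewrite /ball/= ltr_norml; apply/andP; split; lra.
apply: countable_bigcupT_measurable; first exact: countableP.
by move=> q; case: ifP => // _; exact: measurable_box.
Qed.

Lemma open_continuous_measurable_fun_rV (D : set 'rV[R]_n) (f : 'rV[R]_n -> R) :
  open D -> {in D, continuous f} -> measurable_fun D f.
Proof.
move=> oD cf; apply: (measurability _ (RGenOInfty.measurableE R)).
move=> _ [_ [t ->] <-]; apply: open_measurable_rV.
rewrite openE => x [Dx /= xt]; apply: filterI; first exact: oD.
apply: cf; first by rewrite inE.
apply: open_nbhs_nbhs; split => //; exact: itv_open.
Qed.

End lebesgue_boxes.

(** * Covers of a box by boxes have at least its volume *)

Section lebesgue_box_lower_bound.
Context {R : realType}.
Local Open Scope ereal_scope.

(** Corners are plain functions so that an induction on the dimension can drop a coordinate.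
    Truncation at 0 gives volume 0 to boxes with a reversed side. *)
Definition fvol n (a b : 'I_n -> R) : R := (\prod_i Num.max 0 (b i - a i))%R.

Lemma fvol_ge0 n (a b : 'I_n -> R) : (0 <= fvol a b)%R.
Proof. by apply: prodr_ge0 => i _; rewrite le_max lexx. Qed.

Lemma nneseries_ge_term (f : nat -> \bar R) k :
  (forall i, 0 <= f i) -> f k <= \sum_(i <oo) f i.
Proof.
move=> f0; rewrite (nneseriesD1 (n := k))//= leeDl//.
by apply: nneseries_ge0.
Qed.

(* Slicing along the first coordinate: the induction hypothesis bounds the
   volume of every slice, and the bound is integrated over the slices. *)
Lemma fvol_cover n (a b : 'I_n -> R) (m : nat -> bool) (A B : nat -> 'I_n -> R) :
  (forall x : 'I_n -> R, (forall i, a i <= x i <= b i)%R ->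
    exists k, m k /\ (forall i, A k i <= x i <= B k i)%R) ->
  (fvol a b)%:E <= \sum_(k <oo) ((m k)%:R * fvol (A k) (B k))%:E.
Proof.
elim: n a b m A B => [|n IH] a b m A B cov.
  have [|k [mk _]] := cov (fun=> 0%R); first by case.
  apply: le_trans (nneseries_ge_term k _).
    by rewrite mk mul1r /fvol !big_ord0.
  by move=> i; rewrite lee_fin mulr_ge0// fvol_ge0.
pose tl (c : 'I_n.+1 -> R) i := c (lift ord0 i).
have volS c d : fvol c d = (Num.max 0 (d ord0 - c ord0) * fvol (tl c) (tl d))%R.
  by rewrite /fvol big_ord_recl.
have term_ge0 (k : nat) : (0 <= (m k)%:R * fvol (tl (A k)) (tl (B k)))%R.
  by rewrite mulr_ge0// fvol_ge0.
have [ba|ab] := leP (b ord0) (a ord0).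
  rewrite volS max_l ?subr_le0// mul0r; apply: nneseries_ge0 => k _ _.
  by rewrite lee_fin mulr_ge0// fvol_ge0.
pose I k : set R := `[A k ord0, B k ord0]%classic.
pose D : set R := `[a ord0, b ord0]%classic.
pose g k t := ((m k)%:R * fvol (tl (A k)) (tl (B k)))%:E * (\1_(I k) t)%:E.
have slice t : D t -> (fvol (tl a) (tl b))%:E <= \sum_(k <oo) g k t.
  rewrite /D /= in_itv /= => /andP[at_ tb].
  (* The boolean mask discards the boxes that miss the slice at t. It also carries the base case,
     where dimension 0 leaves only the question whether some box is present. *)
  apply: le_trans (IH (tl a) (tl b) (fun k => m k && (t \in I k))
     (fun k => tl (A k)) (fun k => tl (B k)) _) _.
    move=> x xab.
    have [|k [mk kx]] :=
      cov (fun i => if unlift ord0 i is Some j then x j else t).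
      move=> i; case: unliftP => [j ->|->]; first exact: xab.
      by rewrite at_ tb.
    exists k; split; last by move=> i; have := kx (lift ord0 i); rewrite liftK.
    rewrite mk /= inE /I /= in_itv /=.
    by have := kx ord0; rewrite unlift_none.
  apply: lee_nneseries => [k _ _|k _].
    by rewrite lee_fin mulr_ge0// fvol_ge0.
  rewrite /g -EFinM lee_fin indicE; case: (m k) => /=; last by rewrite !mul0r.
  by rewrite !mul1r mulrC.
have mI k : measurable (I k) by exact: measurable_itv.
have mind k : measurable_fun D (fun t => (\1_(I k) t)%:E : \bar R).
  by apply/measurable_EFinP; exact: measurable_indic.
have mg k : measurable_fun D (g k).
  by apply: measurable_funeM; exact: mind.
have g0 k t : D t -> 0 <= g k t by move=> _; rewrite mule_ge0 ?lee_fin.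
have mD : measurable D by exact: measurable_itv.
have lD : lebesgue_measure D = (b ord0 - a ord0)%:E.
  by rewrite /D lebesgue_measure_itv /= lte_fin ab -EFinB.
have H1 : \int[lebesgue_measure]_(t in D) (cst (fvol (tl a) (tl b))%:E) t <=
    \int[lebesgue_measure]_(t in D) (\sum_(k <oo) g k t).
  apply: ge0_le_integral => //.
  - by move=> t _; rewrite lee_fin fvol_ge0.
  - by apply: (@ge0_emeasurable_sum _ _ R D g predT) => // k t Dt _; exact: g0.
move: H1; rewrite integral_cst// [X in _ * X <= _ -> _]lD -EFinM => H1.
rewrite volS max_r ?subr_ge0 ?(ltW ab)// mulrC; apply: le_trans H1 _.
rewrite integral_nneseries//; apply: lee_nneseries => [k _ _|k _].
  by apply: integral_ge0; exact: g0.
rewrite /g ge0_integralZl//=; last 2 first.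
- exact: mind.
- by rewrite lee_fin.
rewrite integral_indic; [|exact: mD|exact: mI].
rewrite (volS (A k) (B k)) mulrCA [leRHS]EFinM muleC.
rewrite lee_wpmul2r ?lee_fin//.
apply: le_trans (_ : lebesgue_measure (I k) <= _).
  apply: le_measure; last exact: subIsetl.
    by apply/mem_set; apply: measurableI => //; exact: mI.
  by apply/mem_set; exact: mI.
rewrite /I lebesgue_measure_itv /= lte_fin; case: ifPn => [AB|_].
  by rewrite -EFinB lee_fin le_max lexx orbT.
by rewrite lee_fin le_max lexx.
Qed.

End lebesgue_box_lower_bound.

(** * The measure of a box, and behaviour under dilations *)

Section lebesgue_box_scaling.
Context {R : realType} {n : nat}.
Implicit Types (a b x y : 'rV[R]_n) (i j : 'I_n) (U : set 'rV[R]_n).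
Local Open Scope ereal_scope.

(** A nonempty box determines its corners, since the corners of either description lie in the other.
    The infimum thus runs over a single value. *)
Lemma box_weightE a b : (forall i, a ord0 i <= b ord0 i)%R ->
  box_weight (box a b) = (\prod_i (b ord0 i - a ord0 i))%:E.
Proof.
move=> ab; apply/eqP; rewrite eq_le box_weight_le//=.
rewrite /box_weight ifF; last by apply/negbTE/set0P; exact: box_ne.
apply: le_ereal_inf_tmp => _ [c [d [cd E ->]]].
have /(_ a) Ea : forall y, box a b y = box c d y by rewrite E.
have /(_ b) Eb : forall y, box a b y = box c d y by rewrite E.
have /(_ c) Ec : forall y, box a b y = box c d y by rewrite E.
have /(_ d) Ed : forall y, box a b y = box c d y by rewrite E.
have boxl (u v : 'rV[R]_n) : (forall i, u ord0 i <= v ord0 i)%R -> box u v u.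
  by move=> uv i; rewrite lexx uv.
have boxr (u v : 'rV[R]_n) : (forall i, u ord0 i <= v ord0 i)%R -> box u v v.
  by move=> uv i; rewrite lexx uv.
have abc : box a b c by rewrite Ec; exact: boxl.
have abd : box a b d by rewrite Ed; exact: boxr.
have cda : box c d a by rewrite -Ea; exact: boxl.
have cdb : box c d b by rewrite -Eb; exact: boxr.
rewrite lee_fin le_eqVlt; apply/orP; left; apply/eqP/eq_bigr => i _.
have /andP[ac _] := abc i; have /andP[_ db] := abd i.
have /andP[ca _] := cda i; have /andP[_ bd] := cdb i.
by congr (_ - _)%R; apply/eqP; rewrite eq_le ?ac ?ca ?db ?bd.
Qed.

(** One covering set of infinite weight settles the claim. Otherwise all of them are empty or boxes,
    and the mask of [fvol_cover] marks the nonempty ones. *)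
Lemma lebesgue_box_ge a b : (forall i, a ord0 i <= b ord0 i)%R ->
  (\prod_i (b ord0 i - a ord0 i))%:E <= lebesgue_outer (box a b).
Proof.
move=> ab; apply: le_ereal_inf_tmp => _ [U abU <-].
have [[k Uoo]|Ufin] := pselect (exists k, box_weight (U k) = +oo).
  apply: le_trans (nneseries_ge_term k _); first by rewrite Uoo leey.
  by move=> i; exact: box_weight_ge0.
have ex k : exists p : bool * (('I_n -> R) * ('I_n -> R)),
   (forall x, U k x -> p.1 /\ forall i, (p.2.1 i <= x ord0 i <= p.2.2 i)%R) /\
   (p.1%:R * fvol p.2.1 p.2.2)%:E <= box_weight (U k).
  have [Uk0|Uk0] := eqVneq (U k) set0.
    exists (false, (fun=> 0%R, fun=> 0%R)); split => [x|]; first by rewrite Uk0.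
    by rewrite mul0r box_weight_ge0.
  have [[c [d [cd Ucd]]]|nbox] := pselect (exists c d : 'rV[R]_n,
      (forall i, c ord0 i <= d ord0 i)%R /\ U k = box c d).
    exists (true, (c ord0, d ord0)); split => [x|/=].
      by rewrite Ucd => H; split.
    rewrite Ucd box_weightE// mul1r lee_fin /fvol le_eqVlt; apply/orP; left.
    by apply/eqP; apply: eq_bigr => i _; rewrite max_r// subr_ge0.
  exfalso; apply: Ufin; exists k.
  rewrite /box_weight (negbTE Uk0) (_ : mkset _ = set0) ?ereal_inf0//.
  by apply/seteqP; split => // v [c [d [cd Ucd _]]]; apply: nbox; exists c, d.
have [p Hp] := choice ex.
have -> : (\prod_i (b ord0 i - a ord0 i))%R = fvol (a ord0) (b ord0).
  by apply: eq_bigr => i _; rewrite max_r// subr_ge0.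
apply: le_trans (_ : \sum_(k <oo) ((p k).1%:R * fvol (p k).2.1 (p k).2.2)%:E <= _).
  apply: fvol_cover => x xab.
  have [|k _ Ukx] := abU (\row_i x i); first by move=> i; rewrite mxE.
  exists k; have [/(_ _ Ukx)[pk1 pk2] _] := Hp k.
  by split => // i; have := pk2 i; rewrite mxE.
apply: lee_nneseries => [k _ _|k _]; last by have [] := Hp k.
by rewrite lee_fin mulr_ge0// fvol_ge0.
Qed.

Lemma lebesgue_boxE a b : (forall i, a ord0 i <= b ord0 i)%R ->
  lebesgue_outer (box a b) = (\prod_i (b ord0 i - a ord0 i))%:E.
Proof.
move=> ab; apply/eqP.
by rewrite eq_le lebesgue_box_le//= lebesgue_box_ge.
Qed.

Definition dilate x (r : R) y : 'rV[R]_n := (r^-1 *: (y - x))%R.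

Lemma preimage_dilate_box x (r : R) a b : (0 < r)%R ->
  dilate x r @^-1` box a b = box (r *: a + x)%R (r *: b + x)%R.
Proof.
move=> r0; apply/seteqP; split => y /= H i; have := H i; rewrite !mxE.
  by rewrite ler_pdivlMl// ler_pdivrMl// lerBrDr lerBlDr.
by rewrite ler_pdivlMl// ler_pdivrMl// lerBrDr lerBlDr.
Qed.

Lemma box_weight_dilate x (r : R) U : (0 < r)%R ->
  (r ^- n)%:E * box_weight (dilate x r @^-1` U) <= box_weight U.
Proof.
move=> r0; have rn0 : (0 < r ^- n)%R by rewrite invr_gt0 exprn_gt0.
have [->|U0] := eqVneq U set0.
  by rewrite preimage_set0 box_weight0 mule0.
rewrite [leRHS]/box_weight (negbTE U0); apply: le_ereal_inf_tmp.
move=> _ [a [b [ab -> ->]]].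
rewrite preimage_dilate_box// box_weightE; last first.
  by move=> i; rewrite !mxE lerD2r ler_pM2l.
rewrite -EFinM lee_fin (eq_bigr (fun i => r * (b ord0 i - a ord0 i)))%R.
  by rewrite big_split /= prodr_const card_ord mulKf ?gt_eqF ?exprn_gt0.
by move=> i _; rewrite !mxE; ring.
Qed.

Lemma lebesgue_dilate_le x (r : R) (A : set 'rV[R]_n) : (0 < r)%R ->
  (r ^- n)%:E * lebesgue_outer (dilate x r @^-1` A) <= lebesgue_outer A.
Proof.
move=> r0; have rn0 : (0 < r ^- n)%R by rewrite invr_gt0 exprn_gt0.
apply: le_ereal_inf_tmp => _ [U AU <-].
apply: le_trans (_ : (r ^- n)%:E * \sum_(k <oo) box_weight (dilate x r @^-1` U k) <= _).
  apply: lee_wpmul2l; first by rewrite lee_fin ltW.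
  apply: ereal_inf_lbound.
  by exists (fun k => dilate x r @^-1` U k) => // y /= /AU [k _ Uky]; exists k.
rewrite -nneseriesZl; last by move=> i _; exact: box_weight_ge0.
apply: lee_nneseries => [k _ _|k _]; last exact: box_weight_dilate.
by apply: mule_ge0; [rewrite lee_fin ltW|exact: box_weight_ge0].
Qed.

Lemma dilateK x (r : R) : (0 < r)%R ->
  cancel (dilate x r) (dilate (- (r^-1 *: x)) r^-1)%R.
Proof.
move=> r0 y; rewrite /dilate invrK opprK scalerDr !scalerA divff ?gt_eqF//.
by rewrite !scale1r subrK.
Qed.

(** The inverse of a dilation is a dilation, so the one-sided estimate applied to both gives
    equality. *)
Lemma lebesgue_dilate x (r : R) (A : set 'rV[R]_n) : (0 < r)%R ->
  lebesgue_outer (dilate x r @^-1` A) = (r ^+ n)%:E * lebesgue_outer A.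
Proof.
move=> r0; have rn0 : (0 < r ^+ n)%R by rewrite exprn_gt0.
apply/eqP; rewrite eq_le; apply/andP; split.
  by have := @lebesgue_dilate_le x r A r0; rewrite lee_pdivrMl.
have := @lebesgue_dilate_le (- (r^-1 *: x))%R r^-1 (dilate x r @^-1` A).
rewrite invr_gt0 -exprVn invrK => /(_ r0).
rewrite -comp_preimage.
have -> : dilate x r \o dilate (- (r^-1 *: x))%R r^-1 = id.
  apply/funext => y /=; have := @dilateK (- (r^-1 *: x))%R r^-1.
  by rewrite invr_gt0 invrK scalerN scalerA divff ?gt_eqF// scale1r opprK => /(_ r0 y).
by rewrite preimage_id.
Qed.

(** Measurable sets are the Caratheodory sets and not only the Borel sets, so looking at preimages
    of boxes would not suffice. Instead the splitting condition is transported: every test set is a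
    preimage under the bijection, and the outer measure scales by a constant factor. *)
Lemma measurable_dilate x (r : R) : (0 < r)%R ->
  measurable_fun [set: 'rV[R]_n] (dilate x r).
Proof.
move=> r0 _ A mA; rewrite setTI.
suff H : (@lebesgue_outer R n).-caratheodory (dilate x r @^-1` A) by exact: H.
move=> X.
have [Y ->] : exists Y, X = dilate x r @^-1` Y.
  exists (dilate (- (r^-1 *: x)) r^-1 @^-1` X)%R.
  by rewrite -comp_preimage (_ : _ \o _ = id)//; apply/funext => y /=; rewrite dilateK.
change (lebesgue_outer (dilate x r @^-1` Y) =
  lebesgue_outer (dilate x r @^-1` (Y `&` A)) +
  lebesgue_outer (dilate x r @^-1` (Y `&` ~` A))).
rewrite !(@lebesgue_dilate x r _ r0) -ge0_muleDr; try exact: outer_measure_ge0.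
congr (_ * _).
exact: (mA : (@lebesgue_outer R n).-caratheodory A).
Qed.

Lemma integral_dilate x (r : R) (g : 'rV[R]_n -> \bar R) : (0 < r)%R ->
  measurable_fun setT g -> (forall y, 0 <= g y) ->
  \int[@lebesgue R n]_y g (dilate x r y) = (r ^+ n)%:E * \int[@lebesgue R n]_y g y.
Proof.
move=> r0 mg g0.
have rn0 : (0 <= r ^+ n)%R by rewrite exprn_ge0// ltW.
have := @ge0_integral_pushforward _ _ _ _ _ _ (@measurable_dilate x r r0)
  (@lebesgue R n) setT g measurableT mg (fun y _ => g0 y).
rewrite preimage_setT => <-.
rewrite (eq_measure_integral (mscale (NngNum rn0) (@lebesgue R n))).
  by rewrite ge0_integral_mscale//; exact: measurableT.
  exact: measurable_dilate.
by move=> ? A mA _; exact: (@lebesgue_dilate x r A r0).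
Qed.

End lebesgue_box_scaling.

(** * Averages against product kernels, and the change of one factor *)

Section mollified_averages.
Context {R : realType} {n : nat}.
Implicit Types (x y a b : 'rV[R]_n) (i j : 'I_n) (p : R * R) (c : 'I_n -> R * R).

(** The pair [p] is (centre, scale). The factor [p.2^-1] makes [sfun p] a primitive, so the mass
    does not depend on the scale. *)
Definition kfun p t : R := p.2^-1 * bump ((t - p.1) / p.2).
Definition sfun p t : R := step ((t - p.1) / p.2).

Definition kernel c : 'rV[R]_n -> R := prodf (fun j => kfun (c j)).

Lemma affine_shiftE p : (fun t : R => (t - p.1) / p.2) =
  (fun t => p.2^-1 * t + - (p.1 / p.2)).
Proof. by apply/funext => t; rewrite mulrBl [t * _]mulrC. Qed.

Lemma smooth1_kfun p : smooth1 (kfun p).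
Proof.
move=> k; have -> : kfun p = cst p.2^-1 * (bump \o (fun t => (t - p.1) / p.2)).
  by apply/funext.
apply: CkM; first exact: Ck_cst.
apply: Ck_comp; first exact: smooth1_bump.
by rewrite affine_shiftE; exact: Ck_affine.
Qed.

Lemma smooth1_sfun p : smooth1 (sfun p).
Proof.
move=> k; have -> : sfun p = step \o (fun t => (t - p.1) / p.2).
  by apply/funext.
apply: Ck_comp; first exact: smooth1_step.
by rewrite affine_shiftE; exact: Ck_affine.
Qed.

Lemma is_derive_sfun p (t : R) : is_derive t (1 : R) (sfun p) (kfun p t).
Proof.
have d1 : is_derive t (1 : R) (fun t => (t - p.1) / p.2) p.2^-1.
  by rewrite affine_shiftE; exact: is_derive_affine.
have := @is_derive1_comp _ step (fun t => (t - p.1) / p.2) t _ _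
  (is_derive_step _) d1.
by move=> H; apply: is_derive_eq H _; rewrite /kfun mulrC.
Qed.

Lemma kfun_ge0 p t : 0 < p.2 -> 0 <= kfun p t.
Proof. by move=> p0; rewrite mulr_ge0 ?invr_ge0 ?(ltW p0)// bump_ge0. Qed.

Lemma ratio_ge1 p t : 0 < p.2 -> ~~ (p.1 - p.2 <= t <= p.1 + p.2) ->
  1 <= `|(t - p.1) / p.2|.
Proof.
move=> p0 H; rewrite normrM (@ger0_norm _ p.2^-1) ?invr_ge0 ?(ltW p0)//.
rewrite ler_pdivlMr// mul1r leNgt ltr_norml; apply: contra H => /andP[h1 h2].
by apply/andP; split; lra.
Qed.

Lemma kfun_out p t : 0 < p.2 -> ~~ (p.1 - p.2 <= t <= p.1 + p.2) ->
  kfun p t = 0.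
Proof. by move=> p0 H; rewrite /kfun bump_out ?mulr0// ratio_ge1. Qed.

(** Right of both supports the two primitives take the same value [step 1]; left of them both
    vanish. This is what gives their difference compact support. *)
Lemma sfunB_out p q (t l r : R) : 0 < p.2 -> 0 < q.2 ->
  l <= p.1 - p.2 -> p.1 + p.2 <= r -> l <= q.1 - q.2 -> q.1 + q.2 <= r ->
  ~~ (l <= t <= r) -> sfun p t - sfun q t = 0.
Proof.
move=> p0 q0 lp pr lq qr; rewrite negb_and -!ltNge => /orP[tl|rt].
  by rewrite /sfun !step_le ?subrr// ler_pdivrMr//; lra.
have E s : 0 < s.2 -> s.1 + s.2 <= r -> sfun s t = step 1.
  by move=> s0 sr; rewrite /sfun step_ge// ler_pdivlMr//; lra.
by rewrite !E// subrr.
Qed.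

Lemma sfunB_le1 p q t : `|sfun p t - sfun q t| <= 1.
Proof.
have := step_ge0 ((t - p.1) / p.2); have := step_le1 ((t - p.1) / p.2).
have := step_ge0 ((t - q.1) / q.2); have := step_le1 ((t - q.1) / q.2).
rewrite /sfun; set y := step _; set z := step _ => z1 z0 y1 y0.
by rewrite ler_norml; apply/andP; split; lra.
Qed.

Lemma continuous_kernel c : continuous (kernel c).
Proof. by apply: continuous_prodf => i; exact/smooth1_continuous/smooth1_kfun. Qed.

Lemma continuous_measurable_rV (k : 'rV[R]_n -> R) (D : set 'rV[R]_n) :
  continuous k -> measurable_fun D k.
Proof.
move=> ck; apply: measurable_funTS.
apply: open_continuous_measurable_fun_rV; first exact: openT.
by move=> x _; exact: ck.
Qed.

(* The factors of [kernel c] have scale at least [r] and its support is in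
   [box a b]. *)
Definition adapted a b (r : R) c : Prop := forall j,
  [/\ r <= (c j).2, a ord0 j <= (c j).1 - (c j).2 & (c j).1 + (c j).2 <= b ord0 j].

Lemma kernel_out a b r c y : 0 < r -> adapted a b r c -> ~ box a b y ->
  kernel c y = 0.
Proof.
move=> r0 ac; apply: contra_notP => /eqP k0 i; apply: contraNT k0 => yi.
have [rc ai bi] := ac i; rewrite /kernel /prodf (bigD1 i)//=.
rewrite kfun_out ?mul0r ?(lt_le_trans r0)//.
apply: contra yi => /andP[h1 h2]; apply/andP; split; lra.
Qed.

Lemma kernel_ge0 r a b c y : 0 < r -> adapted a b r c -> 0 <= kernel c y.
Proof.
move=> r0 ac; apply: prodr_ge0 => i _; apply: kfun_ge0.
by have [rc _ _] := ac i; rewrite (lt_le_trans r0).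
Qed.

Lemma kfun_le (M r : R) p t : (forall s, bump s <= M) -> 0 < r -> r <= p.2 ->
  kfun p t <= M / r.
Proof.
move=> bM r0 rp; have p0 := lt_le_trans r0 rp.
rewrite /kfun mulrC ler_pM ?bump_ge0 ?invr_ge0 ?(ltW p0)//.
by rewrite lef_pV2 ?posrE.
Qed.

Lemma prod_kfun_le (M r : R) (P : pred 'I_n) c y :
  (forall s, bump s <= M) -> 0 < r -> (forall j, r <= (c j).2) ->
  \prod_(j | P j) kfun (c j) (y ord0 j) <= (M / r) ^+ #|P|.
Proof.
move=> bM r0 rc; rewrite -prodr_const; apply: ler_prod => j _.
by rewrite kfun_le// kfun_ge0// (lt_le_trans r0).
Qed.

Lemma integral_abs_mul_le (D B : set 'rV[R]_n) (v k : 'rV[R]_n -> R) (M : R) :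
  measurable D -> measurable B -> B `<=` D -> 0 <= M ->
  measurable_fun D v -> measurable_fun D k ->
  (forall y, `|k y| <= M) -> (forall y, ~ B y -> k y = 0) ->
  (\int[@lebesgue R n]_(y in D) `|(v y * k y)%:E| <=
   M%:E * \int[@lebesgue R n]_(y in B) `|v y|%:E)%E.
Proof.
move=> mD mB BD M0 mv mk kM k0.
have mvn : measurable_fun D (fun y => `|v y|%:E).
  by apply/measurable_EFinP; exact: measurableT_comp.
have -> : (\int[@lebesgue R n]_(y in D) `|(v y * k y)%:E| =
    \int[@lebesgue R n]_(y in B) `|(v y * k y)%:E|)%E.
  rewrite -(setIidr BD) integral_mkcondr; apply: eq_integral => y _.
  rewrite patchE; case: ifPn => // /negP; rewrite in_setE => yB.
  by rewrite k0// mulr0 abse0.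
have mvB := measurable_funS mD BD mvn.
rewrite -ge0_integralZl//.
apply: ge0_le_integral.
- exact: mB.
- by move=> y _; rewrite lee_fin.
- apply/measurable_EFinP/measurableT_comp => //.
  by apply: (measurable_funS mD BD); exact: measurable_funM.
- by apply: measurable_funeM; exact: mvB.
- by move=> y _; rewrite -EFinM lee_fin normrM mulrC ler_wpM2r.
Qed.

Lemma integrable_mul_bounded (D B : set 'rV[R]_n) (v k : 'rV[R]_n -> R) (M : R) :
  measurable D -> compact B -> measurable B -> B `<=` D -> 0 <= M ->
  L1loc D v -> measurable_fun D k ->
  (forall y, `|k y| <= M) -> (forall y, ~ B y -> k y = 0) ->
  (@lebesgue R n).-integrable D (EFin \o (fun y => v y * k y)).
Proof.
move=> mD cB mB BD M0 [mv iv] mk kM k0; apply/integrableP; split.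
  by apply/measurable_EFinP; exact: measurable_funM.
apply: le_lt_trans (integral_abs_mul_le mD mB BD M0 mv mk kM k0) _.
have := iv B BD cB; rewrite -ge0_fin_numE; last exact: integral_ge0.
by move=> /fineK <-; rewrite -EFinM ltry.
Qed.

Variables (D : set 'rV[R]_n) (u : 'rV[R]_n -> R) (g : 'I_n -> 'rV[R]_n -> R).
Hypotheses (oD : open D) (u_loc : L1loc D u) (g_loc : forall i, L1loc D (g i)).
Hypothesis (gu : forall i, weak_partial D i u (g i)).

Let mD : measurable D. Proof. exact: open_measurable_rV. Qed.

Definition average c : R := \int[@lebesgue R n]_(y in D) (u y * kernel c y).

Lemma kernel_bound a b r c : 0 < r -> adapted a b r c ->
  exists2 M, 0 <= M & forall y, `|kernel c y| <= M.
Proof.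
move=> r0 ac; have [M M1 bM] := @bump_bounded R.
exists ((M / r) ^+ #|(fun=> true) : pred 'I_n|).
  by rewrite exprn_ge0// divr_ge0 ?(ltW r0)// (le_trans ler01).
move=> y; rewrite ger0_norm ?(kernel_ge0 _ r0 ac)//.
by apply: prod_kfun_le => // j; have [] := ac j.
Qed.

Lemma integrable_kernel a b r c : 0 < r -> adapted a b r c -> box a b `<=` D ->
  (@lebesgue R n).-integrable D (EFin \o (fun y => u y * kernel c y)).
Proof.
move=> r0 ac abD; have [M M0 kM] := kernel_bound r0 ac.
apply: (@integrable_mul_bounded _ (box a b) _ _ M) => //.
- exact: compact_box.
- exact: measurable_box.
- exact/continuous_measurable_rV/continuous_kernel.
- by move=> y; exact: kernel_out r0 ac.
Qed.

(** If only factor i changes, the difference of the kernels is the i-th partial derivative of [phi],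
    whose i-th factor is the difference of the primitives. The weak derivative turns the difference
    of averages into minus the integral of [g i * phi]. The i-th factor of [phi] is at most 1 in
    absolute value and the other n - 1 are at most [M / r]. *)
Lemma average_upd_le (M : R) a b r c i p : (forall s, bump s <= M) -> 0 <= M ->
  0 < r -> adapted a b r c -> adapted a b r (upd c i p) -> box a b `<=` D ->
  ((`|average c - average (upd c i p)|)%:E <=
   ((M / r) ^+ n.-1)%:E * \int[@lebesgue R n]_(y in box a b) `|g i y|%:E)%E.
Proof.
move=> bM M0 r0 ac acp abD.
pose S : R -> R := sfun (c i) - sfun p.
pose psi j : R -> R := kfun (c j).
pose phi := prodf (upd psi i S).
have [rci aci bci] := ac i.
have [rp ap bp] : [/\ r <= p.2, a ord0 i <= p.1 - p.2 & p.1 + p.2 <= b ord0 i].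
  by have := acp i; rewrite updE.
have sS : smooth1 S.
  move=> k; have -> : S = sfun (c i) + cst (-1) * sfun p.
    by apply/funext => t; rewrite /S !fctE mulN1r.
  apply: CkD; first exact: smooth1_sfun.
  by apply: CkM; [exact: Ck_cst|exact: smooth1_sfun].
have dS t : is_derive t (1 : R) S (kfun (c i) t - kfun p t).
  by apply: is_deriveB; exact: is_derive_sfun.
have S_out t : ~~ (a ord0 i <= t <= b ord0 i) -> S t = 0.
  move=> tab; apply: sfunB_out tab => //; exact: lt_le_trans r0 _.
have phi_out y : ~ box a b y -> phi y = 0.
  apply: contra_notP => /eqP k0 j; apply: contraNT k0 => yj.
  rewrite /phi /prodf (bigD1 j)//= [X in X * _](_ : _ = 0) ?mul0r//.
  rewrite /upd; case: eqP yj => [->|_] yj; first exact: S_out.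
  have [rc aj bj] := ac j; rewrite /psi kfun_out ?(lt_le_trans r0)//.
  by apply: contra yj => /andP[h1 h2]; apply/andP; split; lra.
have tphi : test_function D phi.
  apply: test_function_prodf abD => j.
    by rewrite /upd; case: eqP => // _; exact: smooth1_kfun.
  rewrite /upd; case: eqP => [-> t|_ t tab]; first exact: S_out.
  have [rc aj bj] := ac j; rewrite /psi kfun_out ?(lt_le_trans r0)//.
  by apply: contra tab => /andP[h1 h2]; apply/andP; split; lra.
have dphi y : 'D_(std_basis R i) phi y = kernel c y - kernel (upd c i p) y.
  have dS' t : is_derive t (1 : R) (upd psi i S i) (kfun (c i) t - kfun p t).
    by rewrite updE.
  have := is_derive_prodf y dS' => H; rewrite derive_val.
  have -> : upd (upd psi i S) i (fun t => kfun (c i) t - kfun p t) =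
            upd psi i (fun t => kfun (c i) t - kfun p t).
    by apply/funext => j; rewrite /upd; case: eqP.
  rewrite prodf_upd mulrBl.
  have -> : kernel (upd c i p) = prodf (upd psi i (kfun p)).
    congr prodf; apply/funext => j; rewrite /upd /psi.
    by case: eqP.
  rewrite prodf_upd; congr (_ - _).
  by rewrite /kernel -[in RHS](upd_id (fun j => kfun (c j)) i) prodf_upd.
have phi_le y : `|phi y| <= (M / r) ^+ n.-1.
  rewrite /phi prodf_upd normrM -[leRHS]mul1r ler_pM//; first exact: sfunB_le1.
  rewrite ger0_norm; last first.
    apply: prodr_ge0 => j _; apply: kfun_ge0; have [rc _ _] := ac j.
    exact: lt_le_trans r0 rc.
  have -> : n.-1 = #|(fun j => j != i) : pred 'I_n|.
    by rewrite -[n in LHS]card_ord -(cardC1 i); apply: eq_card.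
  by apply: prod_kfun_le => // j; have [] := ac j.
have mphi : measurable_fun D phi.
  apply: continuous_measurable_rV; case: tphi => sphi _ _.
  by have [] := sphi [::].
have := gu i tphi; under eq_integral do rewrite dphi.
have E : ((average c - average (upd c i p))%:E =
    \int[@lebesgue R n]_(y in D) (u y * (kernel c y - kernel (upd c i p) y))%:E)%E.
  have i1 := integrable_kernel r0 ac abD; have i2 := integrable_kernel r0 acp abD.
  rewrite /average -RintegralB// /Rintegral.
  under [in LHS]eq_integral do rewrite -mulrBr.
  rewrite fineK//; apply: integrable_fin_num => //.
  have := integrableB mD i1 i2; apply: eq_integrable => //= y _.
  by rewrite mulrBr EFinB.
rewrite -E => H.
rewrite -abse_EFin H abseN.
apply: le_trans (le_abse_integral _ mD _) _.
  apply/measurable_EFinP; apply: measurable_funM => //.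
  by have [] := g_loc i.
apply: integral_abs_mul_le => //.
- exact: measurable_box.
- by rewrite exprn_ge0// divr_ge0// ltW.
- by have [] := g_loc i.
Qed.

End mollified_averages.

(** * Averages over cubes: mass of the kernel, comparison, convergence *)

Section averages.
Context {R : realType} {n : nat}.
Implicit Types (x y a b : 'rV[R]_n) (i j : 'I_n) (c : 'I_n -> R * R).

Definition conc x (r : R) : 'I_n -> R * R := fun j => (x ord0 j, r).

Definition cube x (r : R) : set 'rV[R]_n := box (x - const_mx r) (x + const_mx r).

Lemma cubeP x r y : cube x r y <-> forall i, `|y ord0 i - x ord0 i| <= r.
Proof.
split => H i; have := H i; rewrite !mxE ler_norml => /andP[h1 h2];
  by apply/andP; split; lra.
Qed.

Lemma adapted_conc x r : adapted (x - const_mx r) (x + const_mx r) r (conc x r).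
Proof. by move=> j /=; rewrite !mxE; split. Qed.

Lemma lebesgue_cube x r : 0 <= r -> lebesgue_outer (cube x r) = ((2 * r) ^+ n)%:E.
Proof.
move=> r0; rewrite lebesgue_boxE; last by move=> i; rewrite !mxE; lra.
congr EFin; rewrite -[in RHS](card_ord n) -prodr_const.
by apply: eq_bigr => i _; rewrite !mxE; ring.
Qed.

Definition nbump : 'rV[R]_n -> R := prodf (fun=> bump).

(** The bump is not normalised; this finite positive constant stands in for total mass 1. *)
Definition nbump_mass : R := \int[@lebesgue R n]_y nbump y.

Lemma nbump_ge0 y : 0 <= nbump y.
Proof. by apply: prodr_ge0 => i _; exact: bump_ge0. Qed.

Lemma continuous_nbump : continuous nbump.
Proof. by apply: continuous_prodf => i; exact/smooth1_continuous/smooth1_bump. Qed.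

Lemma measurable_nbump : measurable_fun setT (fun y => (nbump y)%:E : \bar R).
Proof.
by apply/measurable_EFinP; exact/continuous_measurable_rV/continuous_nbump.
Qed.

Lemma integral_nbump : (\int[@lebesgue R n]_y (nbump y)%:E = nbump_mass%:E)%E.
Proof.
rewrite /nbump_mass /Rintegral fineK//.
have [M M1 bM] := @bump_bounded R.
have M0 : 0 <= M by exact: le_trans ler01 M1.
have L1 : (@lebesgue R n (cube 0 1) < +oo)%E.
  by rewrite [lebesgue _]lebesgue_cube// ltry.
rewrite ge0_fin_numE; last by apply: integral_ge0 => y _; rewrite lee_fin nbump_ge0.
have -> : (\int[@lebesgue R n]_y (nbump y)%:E =
    \int[@lebesgue R n]_(y in cube 0 1) (nbump y)%:E)%E.
  rewrite [RHS]integral_mkcond; apply: eq_integral => y _.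
  rewrite patchE; case: ifPn => // /negP; rewrite in_setE => yB.
  congr EFin; move: yB; apply: contra_notP => /eqP y0.
  apply/cubeP => i; rewrite mxE subr0; apply: contraNT y0; rewrite -ltNge => yi.
  by rewrite /nbump /prodf (bigD1 i)//= bump_out ?mul0r// ltW.
apply: le_lt_trans (_ : \int[@lebesgue R n]_(y in cube 0 1) (cst (M ^+ n)%:E y) < _)%E.
  apply: ge0_le_integral => //.
  - exact: measurable_box.
  - by move=> y _; rewrite lee_fin nbump_ge0.
  - exact: measurable_funTS measurable_nbump.
  move=> y _; rewrite lee_fin /nbump /prodf -[n in leRHS]card_ord -prodr_const.
  by apply: ler_prod => i _; rewrite bump_ge0 bM.
rewrite integral_cst; last exact: measurable_box.
by apply: lte_mul_pinfty => //; rewrite lee_fin exprn_ge0.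
Qed.

Lemma nbump_mass_gt0 : 0 < nbump_mass.
Proof.
have [e e0 be] := @bump_ge R.
rewrite -lte_fin -integral_nbump.
(* Half-side [2^-1] gives a cube of volume 1, on which every factor is at least e. *)
apply: lt_le_trans (_ : \int[@lebesgue R n]_(y in cube 0 2^-1) (cst (e ^+ n)%:E y) <= _)%E.
  rewrite integral_cst; last exact: measurable_box.
  rewrite [X in (_ * X)%E](_ : _ = ((2 * 2^-1) ^+ n)%:E).
    by rewrite divff ?pnatr_eq0// expr1n mule1 lte_fin exprn_gt0.
  by apply: lebesgue_cube; rewrite invr_ge0.
apply: le_trans (_ : \int[@lebesgue R n]_(y in cube 0 2^-1) (nbump y)%:E <= _)%E.
  apply: ge0_le_integral => //.
  - exact: measurable_box.
  - by move=> y _; rewrite lee_fin exprn_ge0 ?ltW.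
  - exact: measurable_funTS measurable_nbump.
  move=> y /cubeP yc; rewrite lee_fin /nbump /prodf -[n in leLHS]card_ord -prodr_const.
  apply: ler_prod => i _; rewrite ltW//= be//.
  by have := yc i; rewrite mxE subr0.
apply: ge0_subset_integral => //.
- exact: measurable_box.
- exact: measurable_nbump.
- by move=> y _; rewrite lee_fin nbump_ge0.
Qed.

Lemma kernel_concE x r y : 0 < r ->
  kernel (conc x r) y = r ^- n * nbump (dilate x r y).
Proof.
move=> r0; rewrite /kernel /nbump /prodf -exprVn.
have -> : r^-1 ^+ n = \prod_(i < n) r^-1 by rewrite prodr_const card_ord.
rewrite -big_split /=; apply: eq_bigr => i _.
by rewrite /kfun /= !mxE [(_ - _) / _]mulrC.
Qed.

Lemma integral_kernel x r : 0 < r ->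
  (\int[@lebesgue R n]_y (kernel (conc x r) y)%:E = nbump_mass%:E)%E.
Proof.
move=> r0; under eq_integral do rewrite kernel_concE// EFinM.
rewrite ge0_integralZl//; last 3 first.
- apply: (@measurableT_comp _ _ _ _ _ _ (fun y => (nbump y)%:E : \bar R)).
    exact: measurable_nbump.
  exact: measurable_dilate.
- by move=> y _; rewrite lee_fin nbump_ge0.
- by rewrite lee_fin invr_ge0 exprn_ge0// ltW.
rewrite (@integral_dilate _ _ x r (fun y => (nbump y)%:E) r0); last 2 first.
- exact: measurable_nbump.
- by move=> y; rewrite lee_fin nbump_ge0.
rewrite integral_nbump -!EFinM; congr EFin.
by rewrite mulKf// expf_neq0// gt_eqF.
Qed.

Lemma integral_kernel_in (D : set 'rV[R]_n) x r : 0 < r -> cube x r `<=` D ->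
  (\int[@lebesgue R n]_(y in D) (kernel (conc x r) y)%:E = nbump_mass%:E)%E.
Proof.
move=> r0 xD; rewrite -(integral_kernel x r0) integral_mkcond.
apply: eq_integral => y _; rewrite patchE; case: ifPn => // /negP.
rewrite in_setE => yD; rewrite (kernel_out r0 (@adapted_conc x r))// => /xD.
exact: yD.
Qed.

Variables (D : set 'rV[R]_n) (u : 'rV[R]_n -> R) (g : 'I_n -> 'rV[R]_n -> R).
Hypotheses (oD : open D) (u_loc : L1loc D u) (g_loc : forall i, L1loc D (g i)).
Hypothesis (gu : forall i, weak_partial D i u (g i)).

Lemma average_le (M : R) a b r c c' : (forall s, bump s <= M) -> 0 <= M ->
  0 < r -> adapted a b r c -> adapted a b r c' -> box a b `<=` D ->
  ((`|average D u c - average D u c'|)%:E <= ((M / r) ^+ n.-1)%:E *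
     \sum_i \int[@lebesgue R n]_(y in box a b) `|g i y|%:E)%E.
Proof.
move=> bM M0 r0 ac ac' abD.
(* The factors are exchanged one at a time along s. All intermediate kernels stay adapted to the
   same box, so [average_upd_le] applies to each exchange. *)
pose mix (s : seq 'I_n) j := if j \in s then c' j else c j.
have amix s : adapted a b r (mix s) by move=> j; rewrite /mix; case: ifP.
have mixS i s : mix (i :: s) = upd (mix s) i (c' i).
  by apply/funext => j; rewrite /mix /upd inE; case: eqP => [->|].
have Mr0 : 0 <= (M / r) ^+ n.-1 by rewrite exprn_ge0// divr_ge0// ltW.
have H s : ((`|average D u c - average D u (mix s)|)%:E <= ((M / r) ^+ n.-1)%:E *
     \sum_(i <- s) \int[@lebesgue R n]_(y in box a b) `|g i y|%:E)%E.
  elim: s => [|i s IH].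
    by rewrite big_nil mule0 (_ : mix [::] = c)// subrr normr0.
  rewrite big_cons ge0_muleDr; last 2 first.
  - by apply: integral_ge0 => y _; rewrite lee_fin.
  - by apply: sume_ge0 => k _; apply: integral_ge0 => y _; rewrite lee_fin.
  have ai := amix (i :: s); rewrite mixS in ai.
  have := average_upd_le oD u_loc g_loc gu bM M0 r0 (amix s) ai abD.
  rewrite -mixS => H1; apply: le_trans (leeD H1 IH).
  by rewrite -EFinD lee_fin [leRHS]addrC; exact: ler_distD.
rewrite (_ : c' = mix (index_enum 'I_n)); first exact: H.
by apply/funext => j; rewrite /mix mem_index_enum.
Qed.

Lemma average_near x r e : 0 < r -> cube x r `<=` D ->
  (forall y, cube x r y -> `|u y - u x| <= e) ->
  `|average D u (conc x r) - nbump_mass * u x| <= e * nbump_mass.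
Proof.
move=> r0 xD ue.
have ac := @adapted_conc x r.
have mD : measurable D by exact: open_measurable_rV.
have k0 y : 0 <= kernel (conc x r) y by exact: kernel_ge0 r0 ac.
have iu := integrable_kernel oD u_loc r0 ac xD.
have mk : measurable_fun D (kernel (conc x r)).
  exact/continuous_measurable_rV/continuous_kernel.
have ik : (@lebesgue R n).-integrable D (EFin \o kernel (conc x r)).
  apply/integrableP; split; first exact/measurable_EFinP.
  under eq_integral do rewrite /= ger0_norm//.
  by rewrite integral_kernel_in// ltry.
have iuk : (@lebesgue R n).-integrable D (EFin \o (fun y => u x * kernel (conc x r) y)).
  by have := integrableZl mD (u x) ik.
have iek : (@lebesgue R n).-integrable D (EFin \o (fun y => e * kernel (conc x r) y)).
  by have := integrableZl mD e ik.
have Ek : \int[@lebesgue R n]_(y in D) kernel (conc x r) y = nbump_mass.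
  by rewrite /Rintegral integral_kernel_in.
rewrite [nbump_mass * _]mulrC -Ek /average -!RintegralZl// -RintegralB//.
have iB : (@lebesgue R n).-integrable D
    (EFin \o (fun y => u y * kernel (conc x r) y - u x * kernel (conc x r) y)).
  by have := integrableB mD iu iuk.
apply: le_trans (le_normr_Rintegral _ iB) _ => //.
apply: le_Rintegral => //.
  by have /integrable_abse := iB.
move=> y Dy; rewrite -mulrBl normrM (ger0_norm (k0 y))//.
have [yB|yB] := pselect (cube x r y); first by rewrite ler_wpM2r// ue.
by rewrite (kernel_out r0 ac yB) !mulr0.
Qed.

End averages.

(** * The Euclidean norm and the operator norm *)

Section euclidean_norm.
Context {R : realType} {n : nat}.
Implicit Types (x y : 'rV[R]_n) (A : 'M[R]_n) (r : R).

Lemma sum_sqr_ge0 x : 0 <= \sum_i x ord0 i ^+ 2.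
Proof. by apply: sumr_ge0 => i _; exact: sqr_ge0. Qed.

Lemma enorm_ge0 x : 0 <= enorm x. Proof. exact: sqrtr_ge0. Qed.

Lemma sqr_enorm x : enorm x ^+ 2 = \sum_i x ord0 i ^+ 2.
Proof. by rewrite sqr_sqrtr// sum_sqr_ge0. Qed.

Lemma coord_le_enorm x i : `|x ord0 i| <= enorm x.
Proof.
rewrite -[leLHS]sqrtr_sqr ler_sqrt ?sum_sqr_ge0// (bigD1 i)//= lerDl.
by apply: sumr_ge0 => j _; exact: sqr_ge0.
Qed.

Lemma enorm_le_coord x r : (forall i, `|x ord0 i| <= r) -> enorm x <= n%:R * r.
Proof.
move=> xr; case: n x xr => [x _|k x xr].
  by rewrite /enorm big_ord0 sqrtr0 mul0r.
have r0 : 0 <= r by exact: le_trans (xr ord0).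
have -> : k.+1%:R * r = Num.sqrt ((k.+1%:R * r) ^+ 2).
  by rewrite sqrtr_sqr ger0_norm// mulr_ge0.
rewrite ler_sqrt; last exact: sqr_ge0.
apply: le_trans (_ : \sum_(i < k.+1) r ^+ 2 <= _).
  by apply: ler_sum => i _; rewrite -real_normK ?num_real// lerXn2r ?nnegrE.
rewrite sumr_const card_ord -[r ^+ 2 *+ _]mulr_natl exprMn.
by apply: ler_wpM2r; rewrite ?sqr_ge0// expr2 ler_peMl// ler1n.
Qed.

(** With X, Y the two sums of squares and P the scalar product, the sum of the squares of X y_i - P
    x_i equals X (X Y - P^2). *)
Lemma cauchy_schwarz_sum x y :
  (\sum_i x ord0 i * y ord0 i) ^+ 2 <=
  (\sum_i x ord0 i ^+ 2) * (\sum_i y ord0 i ^+ 2).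
Proof.
set X := \sum_i _ ^+ 2; set Y := \sum_i y ord0 i ^+ 2; set P := \sum_i _.
have X0 : 0 <= X by exact: sum_sqr_ge0.
have Q0 : 0 <= \sum_i (X * y ord0 i - P * x ord0 i) ^+ 2.
  by apply: sumr_ge0 => i _; exact: sqr_ge0.
have E : \sum_i (X * y ord0 i - P * x ord0 i) ^+ 2 = X * (X * Y - P ^+ 2).
  transitivity (\sum_i (X ^+ 2 * y ord0 i ^+ 2 -
      (2 * X * P) * (x ord0 i * y ord0 i) + P ^+ 2 * x ord0 i ^+ 2)).
    by apply: eq_bigr => i _; ring.
  rewrite big_split sumrB /= -!mulr_sumr -/X -/Y -/P; ring.
have [X_eq0|X_neq0] := eqVneq X 0.
  have xi i : x ord0 i = 0.
    move/eqP: X_eq0; rewrite psumr_eq0 => [/allP/(_ i)|j _]; last exact: sqr_ge0.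
    by rewrite mem_index_enum /= sqrf_eq0 => /(_ isT)/eqP.
  rewrite X_eq0 mul0r /P big1 ?expr0n// => i _.
  by rewrite xi mul0r.
rewrite -subr_ge0; rewrite E in Q0; rewrite pmulr_rge0 in Q0 => //.
by rewrite lt_def X_neq0.
Qed.

Lemma enormD x y : enorm (x + y) <= enorm x + enorm y.
Proof.
rewrite -(@ler_pXn2r _ 2) ?nnegrE ?addr_ge0 ?enorm_ge0//.
rewrite sqrrD !sqr_enorm.
have -> : \sum_i (x + y) ord0 i ^+ 2 = \sum_i x ord0 i ^+ 2 +
    (\sum_i x ord0 i * y ord0 i) *+ 2 + \sum_i y ord0 i ^+ 2.
  rewrite -sumrMnl -!big_split /=; apply: eq_bigr => i _; rewrite !mxE; ring.
rewrite lerD2r lerD2l lerMn2r/=.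
apply: le_trans (ler_norm _) _.
rewrite -(@ler_pXn2r _ 2) ?nnegrE ?mulr_ge0 ?enorm_ge0//.
by rewrite real_normK ?num_real// exprMn !sqr_enorm cauchy_schwarz_sum.
Qed.

Lemma enormZ r x : enorm (r *: x) = `|r| * enorm x.
Proof.
rewrite -[in RHS]sqrtr_sqr /enorm -sqrtrM ?sqr_ge0//; congr Num.sqrt.
by rewrite mulr_sumr; apply: eq_bigr => i _; rewrite mxE exprMn.
Qed.

Lemma enormN x : enorm (- x) = enorm x.
Proof. by rewrite -scaleN1r enormZ normrN1 mul1r. Qed.


Lemma open_eball r : open (@eball R n r).
Proof.
rewrite openE => x xr.
have e0 : 0 < (r - enorm x) / n.+1%:R by rewrite divr_gt0 ?ltr0n// subr_gt0.
apply/nbhs_ballP; exists ((r - enorm x) / n.+1%:R) => //= y [_ xy].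
rewrite /eball /=.
have : enorm (y - x) <= n%:R * ((r - enorm x) / n.+1%:R).
  apply: enorm_le_coord => i; rewrite !mxE distrC ltW//; exact: xy.
have := enormD (y - x) x; rewrite subrK => h1 h2.
have h3 : n%:R * ((r - enorm x) / n.+1%:R) < r - enorm x.
  by rewrite mulrCA gtr_pMr ?subr_gt0// ltr_pdivrMr ?ltr0n// mul1r ltr_nat.
by apply: le_lt_trans h1 _; rewrite -ltrBrDr; exact: le_lt_trans h2 h3.
Qed.

(** A bound on the set is required before [sup] can serve as an upper bound; the sum of the absolute
    values of the entries provides one. *)
Lemma opnorm_has_sup A :
  has_sup [set enorm (h *m A) | h in [set h : 'rV[R]_n | enorm h <= 1]].
Proof.
split; first by exists (enorm (0 *m A)), 0 => //=; rewrite -(scale0r 0) enormZ normr0 mul0r.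
exists (n%:R * \sum_i \sum_j `|A i j|) => _ [h /= h1 <-].
apply: enorm_le_coord => j; rewrite mxE.
apply: le_trans (ler_norm_sum _ _ _) _; apply: ler_sum => i _.
rewrite normrM (bigD1 j)//= -[leLHS]addr0 lerD//.
  by rewrite ler_piMl// (le_trans (coord_le_enorm h i)).
by apply: sumr_ge0.
Qed.

Lemma entry_le_opnorm A i j : `|A i j| <= opnorm A.
Proof.
have -> : A i j = (std_basis R i *m A) ord0 j by rewrite -rowE mxE.
apply: le_trans (coord_le_enorm _ _) _.
apply: sup_upper_bound; first exact: opnorm_has_sup.
exists (std_basis R i) => //=.
rewrite /enorm (bigD1 i)//= mxE !eqxx expr1n big1 ?addr0 ?sqrtr1// => k ki.
by rewrite mxE (negPf ki) andbF expr0n.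
Qed.

Lemma opnorm_ge0 A : 0 <= opnorm A.
Proof.
apply: le_trans (enorm_ge0 (0 *m A)) _.
apply: sup_upper_bound; first exact: opnorm_has_sup.
by exists 0 => //=; rewrite -(scale0r 0) enormZ normr0 mul0r.
Qed.

End euclidean_norm.

(** * The pointwise splitting of the differential *)

Section distortion.
Context {R : realType}.

(* If [d] exceeds [A k^p] and [C], then [k <= (d / A)^(1/p)] gives
   [d * C^(n-1-1/p) <= d^(n-1/p) <= A^(-1/p) J]. *)
Lemma distortion_bound (n : nat) (p A C d k J : R) :
  0 < p -> 0 < A -> 0 < C -> 0 <= d -> 1 <= k -> 0 <= J ->
  p^-1 <= n%:R - 1 -> d ^+ n <= k * J ->
  d <= A * k `^ p + C + A `^ (- p^-1) * C `^ (- (n%:R - 1 - p^-1)) * J.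
Proof.
move=> p0 A0 C0 d0 k1 J0 pn dkJ.
have k0 : 0 < k by exact: lt_le_trans k1.
have T0 : 0 <= A `^ (- p^-1) * C `^ (- (n%:R - 1 - p^-1)) * J.
  by rewrite !mulr_ge0 ?powR_ge0.
have Ak0 : 0 <= A * k `^ p by rewrite mulr_ge0 ?powR_ge0// ltW.
have [dA|Ad] := leP d (A * k `^ p); first by lra.
have [dC|Cd] := leP d C; first by lra.
suff : d <= A `^ (- p^-1) * C `^ (- (n%:R - 1 - p^-1)) * J by lra.
have dp : 0 < d by exact: lt_trans Cd.
have dAp : k <= (d / A) `^ p^-1.
  have -> : k = (k `^ p) `^ p^-1.
    by rewrite -powRrM divff ?gt_eqF// powRr1// ltW.
  apply: ge0_ler_powR; rewrite ?nnegrE ?powR_ge0 ?invr_ge0 ?divr_ge0 ?(ltW p0) ?(ltW A0)//.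
  by rewrite ler_pdivlMr// mulrC ltW.
have dpow : d ^+ n = d * (d `^ p^-1 * d `^ (n%:R - 1 - p^-1)).
  rewrite -powRD; last by rewrite (gt_eqF dp) implybT.
  rewrite -{2}(powRr1 d0) -powRD; last by rewrite (gt_eqF dp) implybT.
  by rewrite -powR_mulrn//; congr powR; ring.
have AE : (d / A) `^ p^-1 = d `^ p^-1 * A `^ (- p^-1).
  rewrite powRM ?invr_ge0 ?(ltW A0)//; congr (_ * _).
  by rewrite -powR_inv1 ?(ltW A0)// -powRrM mulN1r.
have CE : C `^ (n%:R - 1 - p^-1) <= d `^ (n%:R - 1 - p^-1).
  by apply: ge0_ler_powR; rewrite ?nnegrE ?subr_ge0// ltW.
have H1 : d * C `^ (n%:R - 1 - p^-1) <= A `^ (- p^-1) * J.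
  rewrite -(ler_pM2l (powR_gt0 p^-1 dp)).
  apply: le_trans (_ : d ^+ n <= _).
    by rewrite dpow mulrCA ler_wpM2l// ler_wpM2l// powR_ge0.
  apply: le_trans dkJ _; apply: le_trans (ler_wpM2r J0 dAp) _.
  by rewrite AE mulrA.
by rewrite mulrAC (powRN C) ler_pdivlMr ?powR_gt0.
Qed.

End distortion.

(** * Integrals of the weak derivatives over cubes *)

Section finite_distortion_estimates.
Context {R : realType} {n : nat}.
Variables (p M : R) (f : 'rV[R]_n -> 'rV[R]_n) (Df : 'rV[R]_n -> 'M[R]_n).
Variable K : 'rV[R]_n -> \bar R.
Hypotheses (p0 : 0 < p) (pn : p^-1 <= n%:R - 1).
Hypothesis fd : finite_distortion f Df K.
Hypothesis KM : (\int[@lebesgue R n]_(x in eball 1%R) poweR (K x) p <= M%:E)%E.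

Let D : set 'rV[R]_n := eball 1.
Let mD : measurable D. Proof. exact/open_measurable_rV/open_eball. Qed.

(** Almost everywhere 0 <= |Df|^n <= K J with 1 <= K finite. This reconciles the growth hypothesis,
    stated for J, with heaviness of cubes, stated for |J|. *)
Lemma ae_jac_ge0 : {ae @lebesgue R n, forall x, D x -> 0 <= jac Df x}.
Proof.
have Kfin := fd_K_fin fd; have Kdist := fd_distortion fd.
apply: filterS2 Kfin Kdist => x Kx dx Dx.
have := dx Dx; have := Kx Dx; have := fd_K_ge1 fd Dx.
case: (K x) => [k| |]//; rewrite lee_fin => k1 _.
rewrite -EFinM lee_fin => H; rewrite leNgt; apply/negP => J0.
have := le_trans (exprn_ge0 n (opnorm_ge0 (Df x))) H.
by rewrite leNgt pmulr_rlt0 ?J0// (lt_le_trans _ k1).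
Qed.

Lemma integral_jac (r : R) : r <= 1 ->
  (\int[@lebesgue R n]_(x in eball r) `|jac Df x|%:E =
   \int[@lebesgue R n]_(x in eball r) (jac Df x)%:E)%E.
Proof.
move=> r1.
have rD : eball r `<=` D by move=> x /lt_le_trans; apply.
have mr : measurable (eball r : set 'rV[R]_n).
  exact/open_measurable_rV/open_eball.
have [mJ _] := fd_jacobian fd.
have mJr := measurable_funS mD rD mJ.
apply: ae_eq_integral.
- exact: mr.
- by apply/measurable_EFinP; exact: measurableT_comp.
- exact/measurable_EFinP.
by apply: filterS ae_jac_ge0 => x J0 xr; rewrite ger0_norm// J0//; exact: rD.
Qed.

(** The splitting is integrated over Q. The integral of K^p is bounded by its value on the whole
    ball, so smallness of the first term must come from A. *)
Lemma integral_entry_le (Q : set 'rV[R]_n) (A C : R) i j :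
  measurable Q -> Q `<=` D -> 0 < A -> 0 < C ->
  (\int[@lebesgue R n]_(x in Q) `|Df x i j|%:E <=
   (A * M)%:E + C%:E * @lebesgue R n Q +
   (A `^ (- p^-1) * C `^ (- (n%:R - 1 - p^-1)))%:E *
     \int[@lebesgue R n]_(x in Q) `|jac Df x|%:E)%E.
Proof.
move=> mQ QD A0 C0; set B := A `^ _ * _.
have B0 : 0 <= B by rewrite mulr_ge0 ?powR_ge0.
have mK : measurable_fun D (fun x => poweR (K x) p).
  exact: (measurableT_comp (measurable_poweR p) (fd_K_measurable fd)).
have mKQ := measurable_funS mD QD mK.
have [mJ _] := fd_jacobian fd.
have mJQ := measurable_funS mD QD mJ.
have mJQ' : measurable_fun Q (fun x => `|jac Df x|%:E).
  by apply/measurable_EFinP; exact: measurableT_comp.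
have [_ /(_ i)[[mDf _] _]] := fd_sobolev fd j.
have mDfQ := measurable_funS mD QD mDf.
have KpQ : (\int[@lebesgue R n]_(x in Q) poweR (K x) p <= M%:E)%E.
  apply: le_trans KM; apply: ge0_subset_integral => //.
  by move=> x _; exact: poweR_ge0.
have m1 : measurable_fun Q (fun x => A%:E * poweR (K x) p)%E.
  exact: measurable_funeM.
have m3 : measurable_fun Q (fun x => B%:E * `|jac Df x|%:E)%E.
  exact: measurable_funeM.
have m2 : measurable_fun Q (fun x => A%:E * poweR (K x) p + C%:E)%E.
  by apply: emeasurable_funD.
have g1 x : (0 <= A%:E * poweR (K x) p)%E.
  by rewrite mule_ge0 ?lee_fin ?(ltW A0)// poweR_ge0.
have g2 x : (0 <= A%:E * poweR (K x) p + C%:E)%E.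
  by rewrite adde_ge0 ?lee_fin ?(ltW C0).
have g3 x : (0 <= B%:E * `|jac Df x|%:E)%E by rewrite mule_ge0 ?lee_fin.
apply: le_trans (_ : \int[@lebesgue R n]_(x in Q)
  ((A%:E * poweR (K x) p + C%:E) + B%:E * `|jac Df x|%:E) <= _)%E.
  apply: ae_ge0_le_integral.
  - exact: mQ.
  - by move=> x _; rewrite lee_fin.
  - by apply/measurable_EFinP; exact: measurableT_comp.
  - by move=> x _; rewrite adde_ge0.
  - exact: emeasurable_funD.
  have Kfin := fd_K_fin fd; have Kdist := fd_distortion fd.
  apply: filterS3 ae_jac_ge0 Kfin Kdist => x J0 Kx dx Qx.
  have Dx := QD x Qx; have := dx Dx; have := Kx Dx; have := fd_K_ge1 fd Dx.
  case: (K x) => [k| |]//; rewrite lee_fin => k1 _.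
  rewrite poweR_EFin -!EFinM -!EFinD !lee_fin => H.
  apply: le_trans (entry_le_opnorm _ _ _) _; rewrite ger0_norm ?J0//.
  by apply: distortion_bound H => //; [exact: opnorm_ge0|exact: J0].
rewrite ge0_integralD//; apply: leeD; last first.
  by rewrite ge0_integralZl// lee_fin.
rewrite ge0_integralD//; last by move=> x _; rewrite lee_fin ltW.
apply: leeD; last by rewrite integral_cst.
rewrite ge0_integralZl//; last 2 first.
- by move=> x _; exact: poweR_ge0.
- by rewrite lee_fin ltW.
by rewrite EFinM lee_pmul2l// lte_fin.
Qed.

(** A and C are chosen so that the first two terms are multiples of r^(n-1+d), the volume (4 r)^n of
    the cube giving the constant [4 ^+ n]. The exponent n/p + n d in the assumption on J is then the
    one that makes the third term equal to r^(n-1+d) as well. *)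
Lemma integral_entry_cube_le (x : 'rV[R]_n) (r d : R) i j :
  0 < r -> cube x (2 * r) `<=` D ->
  (\int[@lebesgue R n]_(y in cube x (2 * r)%R) `|jac Df y|%:E <=
    (r `^ (n%:R / p + n%:R * d))%:E)%E ->
  (\int[@lebesgue R n]_(y in cube x (2 * r)%R) `|Df y i j|%:E <=
    ((M + 4 ^+ n + 1) * r `^ (n%:R - 1 + d))%:E)%E.
Proof.
move=> r0 xD Jr.
have rN : r != 0 by rewrite gt_eqF.
have A0 : 0 < r `^ (n%:R - 1 + d) by rewrite powR_gt0.
have C0 : 0 < r `^ (d - 1) by rewrite powR_gt0.
apply: le_trans (integral_entry_le i j (measurable_box _ _) xD A0 C0) _.
rewrite [lebesgue _]lebesgue_cube; last by rewrite mulr_ge0// ltW.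
set B := (_ `^ _) `^ _ * _.
have B0 : 0 <= B by rewrite mulr_ge0 ?powR_ge0.
have : (B%:E * \int[@lebesgue R n]_(y in cube x (2 * r)%R) `|jac Df y|%:E <=
    B%:E * (r `^ (n%:R / p + n%:R * d))%:E)%E by rewrite lee_wpmul2l// lee_fin.
move=> H; apply: le_trans (leeD (lexx _) H) _.
rewrite -!EFinM -!EFinD lee_fin.
have -> : B * r `^ (n%:R / p + n%:R * d) = r `^ (n%:R - 1 + d).
  rewrite /B -!powRrM -!powRD ?rN ?implybT//; congr powR; field.
  by rewrite gt_eqF.
have -> : r `^ (d - 1) * (2 * (2 * r)) ^+ n = 4 ^+ n * r `^ (n%:R - 1 + d).
  rewrite (_ : 2 * (2 * r) = 4 * r); last by ring.
  rewrite exprMn mulrCA; congr (_ * _).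
  rewrite -powR_mulrn ?(ltW r0)// -powRD ?rN ?implybT//; congr powR; ring.
by rewrite !mulrDl mul1r [_ * M]mulrC.
Qed.

End finite_distortion_estimates.

(** * Left limits from geometric decay of increments *)

Section geometric_scales.
Context {R : realType}.
Implicit Types (m k N : nat).

Lemma small_expr (l e : R) : 0 <= l -> l < 1 -> 0 < e ->
  exists N, forall m, (N <= m)%N -> l ^+ m < e.
Proof.
move=> l0 l1 e0.
have : (fun k : nat => l ^+ k) @ \oo --> (0 : R).
  by apply: cvg_expr; rewrite ger0_norm.
move=> /cvgrPdist_lt /(_ e e0) [N _ H]; exists N => m Nm.
by have := H m Nm; rewrite sub0r normrN ger0_norm// exprn_ge0.
Qed.

Lemma geometric_telescope (F : nat -> R) (C mu : R) m : 0 <= C -> 0 <= mu -> mu < 1 ->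
  (forall k, (m <= k)%N -> `|F k - F k.+1| <= C * mu ^+ k) ->
  forall N, `|F m - F (m + N)%N| <= C * mu ^+ m / (1 - mu).
Proof.
move=> C0 mu0 mu1 H N.
have mu1' : 0 < 1 - mu by rewrite subr_gt0.
(* The finite geometric sum is kept because the bound by the full series does not pass through the
   induction on N. *)
suff S : `|F m - F (m + N)%N| <= C * mu ^+ m * ((1 - mu ^+ N) / (1 - mu)).
  apply: le_trans S _; rewrite ler_wpM2l ?mulr_ge0 ?exprn_ge0//.
  by rewrite -[leRHS]mul1r ler_wpM2r ?invr_ge0 ?(ltW mu1')// gerBl exprn_ge0.
elim: N => [|N IH].
  by rewrite addn0 subrr normr0 expr0 subrr mul0r mulr0.
have HN := H (m + N)%N (leq_addr _ _).
rewrite addnS -(subrK (F (m + N)%N) (F m)) -addrA.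
apply: le_trans (ler_normD _ _) _; apply: le_trans (lerD IH HN) _.
rewrite exprD exprS le_eqVlt; apply/orP; left; apply/eqP.
by field; rewrite gt_eqF.
Qed.

(** From 1 - l^m one telescopes along the points 1 - l^k up to the interval that contains t and
    makes one last step inside it. So v deviates from its value at 1 - l^m by O(mu^m) on [1 - l^m,
    1), and the Cauchy criterion applies. *)
Lemma left_limit_of_geometric (v : R -> R) (l C mu : R) (m0 : nat) :
  0 < l -> l < 1 -> 0 <= C -> 0 <= mu -> mu < 1 ->
  (forall m t, (m0 <= m)%N -> 1 - l ^+ m <= t -> t <= 1 - l ^+ m.+1 ->
     `|v (1 - l ^+ m) - v t| <= C * mu ^+ m) ->
  exists z : R, v t @[t --> (1 : R)^'-] --> z.
Proof.
move=> l0 l1 C0 mu0 mu1 H.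
have mu1' : 0 < 1 - mu by rewrite subr_gt0.
have H1 m t : (m0 <= m)%N -> 1 - l ^+ m <= t -> t < 1 ->
    `|v (1 - l ^+ m) - v t| <= C * (1 + (1 - mu)^-1) * mu ^+ m.
  move=> m0m tm t1.
  have [k [mk kt tk]] : exists k, [/\ (m <= k)%N, 1 - l ^+ k <= t & t <= 1 - l ^+ k.+1].
    have ex : exists k, t <= 1 - l ^+ k.
      have t1' : 0 < 1 - t by rewrite subr_gt0.
      have [N HN] := small_expr (ltW l0) l1 t1'.
      by exists N; have := HN N (leqnn N) => ?; lra.
    have [k tk kmin] := ex_minnP ex.
    (* Here k is the least index with t <= 1 - l^k. If k <= m then t is the left end 1 - l^m and
       index m works; otherwise the predecessor of k does. *)
    have [km|mk] := leqP k m.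
      have lkm : l ^+ m <= l ^+ k by rewrite ler_wiXn2l// ltW.
      have lm : l ^+ m.+1 <= l ^+ m by rewrite ler_wiXn2l// ltW.
      by exists m; split => //; lra.
    case: k tk kmin mk => // k tk kmin mk.
    exists k; split => //; rewrite leNgt; apply/negP => tk'.
    by have := kmin k (ltW tk'); rewrite ltnn.
  have T := @geometric_telescope (fun k => v (1 - l ^+ k)) C mu m C0 mu0 mu1 _ (k - m)%N.
  rewrite subnKC// in T.
  have {}T : `|v (1 - l ^+ m) - v (1 - l ^+ k)| <= C * mu ^+ m / (1 - mu).
    apply: T => j mj; apply: H; first exact: leq_trans mj.
      by rewrite lerD2l lerN2 ler_wiXn2l// ltW.
    exact: lexx.
  have S := H k t (leq_trans m0m mk) kt tk.
  rewrite -(subrK (v (1 - l ^+ k)) (v (1 - l ^+ m))) -addrA.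
  apply: le_trans (ler_normD _ _) _; apply: le_trans (lerD T S) _.
  have : C * mu ^+ k <= C * mu ^+ m.
    by rewrite ler_wpM2l// ler_wiXn2l// ltW.
  have -> : C * (1 + (1 - mu)^-1) * mu ^+ m = C * mu ^+ m / (1 - mu) + C * mu ^+ m.
    by ring.
  lra.
apply/cvg_ex/cauchy_cvgP; apply: cauchy_exP => e e0 /=.
have C' : 0 <= C * (1 + (1 - mu)^-1).
  by rewrite mulr_ge0// addr_ge0// invr_ge0 ltW.
have [N HN] := @small_expr mu (e / (C * (1 + (1 - mu)^-1) + 1)) mu0 mu1
  ltac:(rewrite divr_gt0//; lra).
pose m := maxn N m0.
exists (v (1 - l ^+ m)).
have lm0 : 1 - l ^+ m < 1 by rewrite ltrBlDr ltrDl exprn_gt0.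
near=> t; rewrite /ball /=.
apply: le_lt_trans (H1 m t (leq_maxr _ _) _ _) _.
- by apply: ltW; near: t; exact: nbhs_left_gt.
- by near: t; exact: nbhs_left_lt.
have := HN m (leq_maxl _ _); rewrite ltr_pdivlMr; last by lra.
have : 0 <= mu ^+ m by rewrite exprn_ge0.
move: C'; set c := C * _; nra.
Unshelve. all: by end_near. Qed.

End geometric_scales.

(** * Existence of the radial limit when the derivative is small on cubes *)

Section radial_limit_along_good_directions.
Context {R : realType} {n : nat}.
Implicit Types (x y : 'rV[R]_n) (i j : 'I_n) (t : R).

(* The scales [lam^m] are so close together that the points [(1 - lam^m) x]
   and [(1 - lam^(m+1)) x] are within [rad m] of each other. *)
Definition eps : R := (8 * n%:R)^-1.
Definition lam : R := 1 - eps.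
Definition rad m : R := eps * lam ^+ m.

Hypothesis n_gt0 : (0 < n)%N.

Let n1 : 1 <= n%:R :> R. Proof. by rewrite ler1n. Qed.

Lemma eps_gt0 : 0 < eps.
Proof. by rewrite invr_gt0; move: n1; lra. Qed.

Lemma epsE : 8 * n%:R * eps = 1.
Proof. by rewrite divff// gt_eqF//; move: n1; lra. Qed.

Lemma eps_le : eps <= 8^-1.
Proof. have := epsE; have := eps_gt0; have := n1; nra. Qed.

Lemma lam_gt0 : 0 < lam. Proof. by have := eps_le; rewrite /lam; lra. Qed.

Lemma lam_lt1 : lam < 1. Proof. by have := eps_gt0; rewrite /lam; lra. Qed.

Lemma rad_gt0 m : 0 < rad m.
Proof. by rewrite mulr_gt0 ?eps_gt0// exprn_gt0// lam_gt0. Qed.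

Lemma radS_le m : rad m.+1 <= rad m.
Proof.
rewrite ler_wpM2l ?(ltW eps_gt0)// ler_wiXn2l ?(ltW lam_gt0)//.
exact: ltW lam_lt1.
Qed.

Lemma rad_le_double m : rad m <= 2 * rad m.+1.
Proof.
have -> : 2 * rad m.+1 = (2 * lam) * rad m by rewrite /rad exprS; ring.
by rewrite ler_peMl ?(ltW (rad_gt0 m))// /lam; have := eps_le; lra.
Qed.

Lemma lam_step m : (1 - lam ^+ m.+1) - (1 - lam ^+ m) = rad m.
Proof. by rewrite /rad exprS {1}/lam; ring. Qed.

(** Because 8 n eps = 1, the added term is half of lam^m, while 1 - t >= lam^(m+1) >= (7/8)
    lam^m. *)
Lemma rad_room m t : t <= 1 - lam ^+ m.+1 -> t + 4 * n%:R * rad m < 1.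
Proof.
rewrite /rad exprS {1}/lam => tm.
have : 0 < lam ^+ m by rewrite exprn_gt0// lam_gt0.
have := epsE; have := eps_le; move: tm; set L := lam ^+ m; set E := eps.
move=> tm E8 E1 L0.
have -> : 4 * n%:R * (E * L) = L / 2.
  by transitivity ((8 * n%:R * E) * L / 2); [field|rewrite E1 mul1r].
nra.
Qed.

(** Half of the room 4 n rad m is used up by the cube, in Euclidean norm. The other half is the
    distance to the sphere at which the growth of the Jacobian integral is evaluated later. *)
Lemma cube_in_eball x t m y : esphere x -> 0 <= t -> t <= 1 - lam ^+ m.+1 ->
  cube (t *: x) (2 * rad m) y -> eball (1 - 2 * n%:R * rad m) y.
Proof.
move=> x1 t0 tm /cubeP yt; rewrite /eball /=.
have h1 : enorm (y - t *: x) <= n%:R * (2 * rad m).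
  by apply: enorm_le_coord => i; have := yt i; rewrite !mxE.
have := enormD (y - t *: x) (t *: x); rewrite subrK enormZ x1 mulr1 ger0_norm// => h2.
have := rad_room tm => h3.
have : n%:R * (2 * rad m) = 2 * n%:R * rad m by ring.
have : 4 * n%:R * rad m = 2 * n%:R * rad m + 2 * n%:R * rad m by ring.
move: h1 h2 h3; set e1 := enorm _; set e2 := enorm _.
set a1 := n%:R * _; set a2 := 4 * _ * _; set a3 := 2 * _ * _.
lra.
Qed.

Lemma eball_sub (r : R) : r <= 1 -> (@eball R n r) `<=` eball 1.
Proof. by move=> r1 x /lt_le_trans; apply. Qed.

Lemma cube_in_ball x t m : esphere x -> 0 <= t -> t <= 1 - lam ^+ m.+1 ->
  cube (t *: x) (2 * rad m) `<=` eball 1.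
Proof.
move=> x1 t0 tm y /(cube_in_eball x1 t0 tm); apply: eball_sub.
by rewrite gerBl; apply: mulr_ge0; [rewrite mulr_ge0|exact/ltW/rad_gt0].
Qed.

Variables (u : 'rV[R]_n -> R) (g : 'I_n -> 'rV[R]_n -> R) (x : 'rV[R]_n).
Variables (G mu : R) (m0 : nat).
Let D : set 'rV[R]_n := eball 1.
Hypotheses (u_loc : L1loc D u) (g_loc : forall i, L1loc D (g i)).
Hypothesis gu : forall i, weak_partial D i u (g i).
Hypothesis cu : {in D, continuous u}.
Hypotheses (x1 : esphere x) (G0 : 0 <= G) (mu0 : 0 <= mu) (mu1 : mu < 1).
Hypothesis flux : forall m t i, (m0 <= m)%N -> 2^-1 <= t -> t <= 1 - lam ^+ m.+1 ->
  (\int[@lebesgue R n]_(y in cube (t *: x) (2 * rad m)%R) `|g i y|%:E <=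
   (G * rad m ^+ n.-1 * mu ^+ m)%:E)%E.

Let oD : open D. Proof. exact: open_eball. Qed.

Let lamS m : 1 - lam ^+ m <= 1 - lam ^+ m.+1.
Proof.
by rewrite lerD2l lerN2 ler_wiXn2l ?(ltW lam_gt0)// ltW// lam_lt1.
Qed.

Let avg t r := average D u (conc (t *: x) r).

Let half0 t : 2^-1 <= t -> 0 <= t.
Proof. by move=> t2; apply: le_trans t2; rewrite invr_ge0. Qed.

(** Covers a move of the centre and a passage to the next scale at once: both kernels fit in the
    cube of half-side 2 rad m about t x. Consecutive radii differ by a factor at most 2, so
    rad^(n-1) in [flux] cancels the kernel bound (M/r)^(n-1) up to a constant and leaves mu^m. *)
Lemma average_change : exists2 C, 0 <= C & forall m t t' r',
  (m0 <= m)%N -> 2^-1 <= t -> t <= 1 - lam ^+ m.+1 -> `|t - t'| <= rad m ->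
  rad m.+1 <= r' -> r' <= rad m -> `|avg t (rad m) - avg t' r'| <= C * mu ^+ m.
Proof.
have [M M1 bM] := @bump_bounded R.
have M0 : 0 <= M by exact: le_trans ler01 M1.
exists ((2 * M) ^+ n.-1 * (n%:R * G)).
  by rewrite mulr_ge0 ?exprn_ge0 ?mulr_ge0.
move=> m t t' r' m0m t2 tm tt' r'1 r'2.
have t0 := half0 t2.
have r0 := rad_gt0 m.+1.
have cD := cube_in_ball x1 t0 tm.
have a1 : adapted (t *: x - const_mx (2 * rad m)) (t *: x + const_mx (2 * rad m))
    (rad m.+1) (conc (t *: x) (rad m)).
  move=> j /=; have := rad_gt0 m; have := radS_le m.
  by rewrite !mxE => ? ?; split; lra.
have a2 : adapted (t *: x - const_mx (2 * rad m)) (t *: x + const_mx (2 * rad m))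
    (rad m.+1) (conc (t' *: x) r').
  move=> j /=; rewrite !mxE.
  have : `|(t - t') * x ord0 j| <= rad m.
    rewrite normrM -[leRHS]mulr1 ler_pM//.
    by have := coord_le_enorm x j; rewrite x1.
  rewrite mulrBl ler_norml => /andP[h1 h2]; split => //; lra.
rewrite -lee_fin.
apply: le_trans (average_le oD u_loc g_loc gu bM M0 r0 a1 a2 cD) _.
have S : (\sum_i \int[@lebesgue R n]_(y in cube (t *: x) (2 * rad m)%R) `|g i y|%:E <=
    (n%:R * (G * rad m ^+ n.-1 * mu ^+ m))%:E)%E.
  apply: le_trans (_ : \sum_(i < n) (G * rad m ^+ n.-1 * mu ^+ m)%:E <= _)%E.
    by apply: lee_sum => i _; exact: flux.
  by rewrite sumEFin sumr_const card_ord mulr_natl.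
have K0 : 0 <= (M / rad m.+1) ^+ n.-1 by rewrite exprn_ge0// divr_ge0// ltW.
apply: le_trans (lee_wpmul2l _ S) _; first by rewrite lee_fin.
rewrite -EFinM lee_fin.
have -> : (M / rad m.+1) ^+ n.-1 * (n%:R * (G * rad m ^+ n.-1 * mu ^+ m)) =
   (M * (rad m / rad m.+1)) ^+ n.-1 * (n%:R * G) * mu ^+ m.
  by rewrite !exprMn; ring.
rewrite ler_wpM2r ?exprn_ge0// ler_wpM2r ?mulr_ge0//.
have q0 : 0 <= rad m / rad m.+1 by rewrite divr_ge0// ltW// rad_gt0.
apply: lerXn2r; [by rewrite nnegrE mulr_ge0|by rewrite nnegrE mulr_ge0|].
rewrite mulrC; apply: ler_wpM2r => //.
by rewrite ler_pdivrMr// rad_le_double.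
Qed.

Lemma rad_small e : 0 < e -> exists N, forall m, (N <= m)%N -> rad m < e.
Proof.
move=> e0; have [N HN] := small_expr (ltW lam_gt0) lam_lt1 e0.
exists N => m /HN; apply: le_lt_trans.
rewrite /rad -[leRHS]mul1r ler_wpM2r ?exprn_ge0 ?(ltW lam_gt0)//.
by have := eps_le; lra.
Qed.

Lemma average_cvg t e : 0 <= t -> t < 1 -> 0 < e -> exists N, forall m, (N <= m)%N ->
  `|avg t (rad m) - nbump_mass (R := R) (n := n) * u (t *: x)| <= e.
Proof.
move=> t0 t1 e0.
have K0 := @nbump_mass_gt0 R n.
have Dt : D (t *: x) by rewrite /D /eball /= enormZ x1 mulr1 ger0_norm.
have := cu (mem_set Dt).
move=> /cvgrPdist_le /(_ (e / nbump_mass (R := R) (n := n))).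
rewrite divr_gt0// => /(_ isT) uV.
have /nbhs_ballP[d /= d0 dV] : nbhs (t *: x) (D `&`
    [set y | `|u (t *: x) - u y| <= e / nbump_mass (R := R) (n := n)]).
  by apply: filterI; [exact: open_nbhs_nbhs (conj oD Dt)|exact: uV].
have [N HN] := rad_small d0.
exists N => m Nm.
have cV : cube (t *: x) (rad m) `<=` ball (t *: x) d.
  move=> y /cubeP yc; split => // i j; rewrite ord1 /ball /= distrC.
  exact: le_lt_trans (yc j) (HN m Nm).
rewrite -[leRHS](divfK (lt0r_neq0 K0)).
apply: average_near => //.
- exact: rad_gt0.
- by move=> y /cV /dV [].
- by move=> y /cV /dV [_] /=; rewrite distrC.
Qed.

Lemma radial_limit : exists z : R, u (t *: x) @[t --> (1 : R)^'-] --> z.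
Proof.
have [C C0 HC] := average_change.
have K0 := @nbump_mass_gt0 R n.
set K := nbump_mass (R := R) (n := n) in K0.
have mu1' : 0 < 1 - mu by rewrite subr_gt0.
have [N HN] := small_expr (ltW lam_gt0) lam_lt1 (ltac:(lra) : (0 : R) < 2^-1).
(* At fixed t the scale is sent to 0. All finer scales are admissible there, since 1 - lam^(k+1)
   increases with k. *)
have near_avg m t : (m0 <= m)%N -> 2^-1 <= t -> t <= 1 - lam ^+ m.+1 ->
    `|avg t (rad m) - K * u (t *: x)| <= C * mu ^+ m / (1 - mu).
  move=> m0m t2 tm; apply/ler_addgt0Pr => e e0.
  have t1 : t < 1.
    by apply: le_lt_trans tm _; rewrite ltrBlDr ltrDl exprn_gt0// lam_gt0.
  have [N' HN'] := average_cvg (half0 t2) t1 e0.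
  have T := @geometric_telescope _ (fun k => avg t (rad k)) C mu m C0 mu0 mu1 _ N'.
  have {}T : `|avg t (rad m) - avg t (rad (m + N'))| <= C * mu ^+ m / (1 - mu).
    apply: T => k mk; apply: HC => //.
    - exact: leq_trans mk.
    - apply: le_trans tm _; rewrite lerD2l lerN2 ler_wiXn2l ?(ltW lam_gt0)//.
      exact: ltW lam_lt1.
    - by rewrite subrr normr0 ltW// rad_gt0.
    - exact: radS_le.
  rewrite -(subrK (avg t (rad (m + N'))) (avg t (rad m))) -addrA.
  by apply: le_trans (ler_normD _ _) _; apply: lerD T (HN' _ (leq_addl _ _)).
apply: (@left_limit_of_geometric _ _ lam
  ((2 * C / (1 - mu) + C) / K) mu (maxn m0 N)) => //.
- exact: lam_gt0.
- exact: lam_lt1.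
- rewrite divr_ge0 ?(ltW K0)// addr_ge0// divr_ge0 ?(ltW mu1')// mulr_ge0//.
move=> m t; rewrite geq_max => /andP[m0m Nm] tm tm'.
have s2 : 2^-1 <= 1 - lam ^+ m by have := HN m Nm; lra.
have t2 : 2^-1 <= t by exact: le_trans tm.
have n1' := near_avg m _ m0m s2 (lamS m).
have n2 := near_avg m _ m0m t2 tm'.
have n3 : `|avg (1 - lam ^+ m) (rad m) - avg t (rad m)| <= C * mu ^+ m.
  apply: HC => //; last exact: radS_le.
  by rewrite distrC ger0_norm ?subr_ge0// -lam_step lerD2r.
rewrite -(ler_pM2l K0) -{1}(gtr0_norm K0) -normrM mulrBr.
set a1 := avg _ _ in n1' n3; set a2 := avg _ _ in n2 n3.
set b1 := K * u _ in n1' *; set b2 := K * u _ in n2 *.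
(* Two passages between value and average, each costing a full geometric series, and one move of the
   centre at scale rad m; division by K yields the constant given above. *)
have -> : b1 - b2 = (b1 - a1) + (a1 - a2) + (a2 - b2) by ring.
apply: le_trans (ler_normD _ _) _.
apply: le_trans (lerD (ler_normD _ _) (lexx _)) _.
rewrite distrC in n1'.
have -> : K * ((2 * C / (1 - mu) + C) / K * mu ^+ m) =
  C * mu ^+ m / (1 - mu) + C * mu ^+ m + C * mu ^+ m / (1 - mu).
  by field; rewrite !gt_eqF.
by apply: lerD n2; exact: lerD.
Qed.

End radial_limit_along_good_directions.

(** * Counting disjoint heavy cubes *)

Section separated_families.
Context {R : realType} {n : nat}.
Implicit Types (x y z : 'rV[R]_n) (s : seq 'rV[R]_n).
Variables (Y E : set 'rV[R]_n) (w : 'rV[R]_n -> R) (r tau T : R).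
Hypotheses (mE : measurable E) (mw : measurable_fun E w) (w0 : forall x, 0 <= w x).
Hypotheses (YE : forall y, Y y -> cube y (2 * r) `<=` E) (r0 : 0 < r) (tau0 : 0 < tau).
Hypothesis heavy : forall y, Y y ->
  (tau%:E <= \int[@lebesgue R n]_(x in cube y (2 * r)%R) (w x)%:E)%E.
Hypothesis total : (\int[@lebesgue R n]_(x in E) (w x)%:E <= T%:E)%E.

(** The constant 4 makes the cubes of half-side 2 r about these centres pairwise disjoint. *)
Definition separated s := pairwise (fun y z => ~~ `[< cube y (4 * r) z >]) s.

Lemma cube_sym (q : R) y z : cube y q z -> cube z q y.
Proof. by move=> /cubeP H; apply/cubeP => i; rewrite distrC. Qed.

Lemma separated_size s : (forall y, y \in s -> Y y) -> separated s ->
  (size s)%:R * tau <= T.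
Proof.
move=> sY ss.
pose U s' : set 'rV[R]_n := [set x | exists2 y, y \in s' & cube y (2 * r) x].
have mU s' : measurable (U s').
  elim: s' => [|y s' IH].
    by rewrite (_ : U [::] = set0)//; apply/seteqP; split => // x [y].
  rewrite (_ : U (y :: s') = cube y (2 * r) `|` U s').
    by apply: measurableU => //; exact: measurable_box.
  apply/seteqP; split => x /=.
    move=> [z]; rewrite inE => /orP[/eqP->|zs] zx; first by left.
    by right; exists z.
  move=> [yx|[z zs zx]]; first by exists y => //; exact: mem_head.
  by exists z => //; rewrite inE zs orbT.
have key : (((size s)%:R * tau)%:E <= \int[@lebesgue R n]_(x in U s) (w x)%:E)%E.
  elim: s sY ss => [_ _|y s IH sY].
    by rewrite mul0r; apply: integral_ge0 => x _; rewrite lee_fin.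
  rewrite /separated /= => /andP[/allP ys ss].
  have sY' z : z \in s -> Y z by move=> zs; apply: sY; rewrite inE zs orbT.
  have Yy : Y y by apply: sY; exact: mem_head.
  have UE : U (y :: s) `<=` E by move=> x [z /sY Yz]; exact: YE.
  have UU : U (y :: s) = cube y (2 * r) `|` U s.
    apply/seteqP; split => x /=.
      move=> [z]; rewrite inE => /orP[/eqP->|zs] zx; first by left.
      by right; exists z.
    move=> [yx|[z zs zx]]; first by exists y => //; exact: mem_head.
    by exists z => //; rewrite inE zs orbT.
  have mwU : measurable_fun (U (y :: s)) (fun x => (w x)%:E).
    by apply/measurable_EFinP; exact: measurable_funS mw.
  rewrite UU ge0_integral_setU//; last 4 first.
  - exact: measurable_box.
  - by rewrite -UU.
  - by move=> x _; rewrite lee_fin.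
  - apply/disj_setPS => x [/cubeP xy [z zs /cubeP xz]].
    have /negP := ys z zs; apply; apply/asboolP/cubeP => i.
    have := xy i; have := xz i; rewrite !ler_norml => /andP[h1 h2] /andP[h3 h4].
    by apply/andP; split; lra.
  rewrite -natr1 mulrDl mul1r addrC EFinD; apply: leeD; first exact: heavy.
  exact: IH.
rewrite -lee_fin; apply: le_trans key _; apply: le_trans _ total.
apply: ge0_subset_integral => //.
- exact/measurable_EFinP.
- by move=> x _; rewrite lee_fin.
- by move=> x [y /sY Yy]; exact: YE.
Qed.

(** Lengths of separated lists are bounded by T / tau, so a longest one exists. A point of Y outside
    all its cubes of half-side 4 r could be added to it. *)
Lemma maximal_separated : exists s, [/\ (size s)%:R * tau <= T,
  (forall y, y \in s -> Y y) &
  (forall y, Y y -> exists2 z, z \in s & cube z (4 * r) y)].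
Proof.
pose P k := `[< exists s, [/\ size s = k, (forall y, y \in s -> Y y) & separated s] >].
have exP : exists k, P k by exists 0%N; apply/asboolP; exists [::].
have bP k : P k -> (k <= Num.truncn (T / tau))%N.
  move=> /asboolP[s [<- sY ss]]; have H := separated_size sY ss.
  rewrite -ler_pdivlMr// in H.
  have T0 : 0 <= T / tau by exact: le_trans H.
  by have := le_truncn H; rewrite natrK.
have [k /asboolP[s [sk sY ss]] kmax] := ex_maxnP exP bP.
exists s; split => //; first exact: separated_size.
move=> y Yy; apply: contrapT => H.
have : P k.+1.
  apply/asboolP; exists (y :: s); split => /=; first by rewrite sk.
    by move=> z; rewrite inE => /orP[/eqP->//|/sY].
  rewrite /separated /=; apply/andP; split => //; apply/allP => z zs.
  by apply/negP => /asboolP yz; apply: H; exists z => //; exact: cube_sym.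
by move=> /kmax; rewrite ltnn.
Qed.

End separated_families.

(** * Upper bounds for measures defined by covers *)

Section covers.
Context {R : realType}.
Local Open Scope ereal_scope.

Lemma cover_measure_le_seq (I : eqType) (T : Type) (w : set T -> \bar R) (A : set T)
    (s : seq I) (U : I -> set T) (W : R) :
  w set0 = 0 -> (forall B, 0 <= w B) ->
  (forall x, A x -> exists2 z, z \in s & U z x) ->
  (forall z, z \in s -> w (U z) <= W%:E) ->
  cover_measure w A <= ((size s)%:R * W)%:E.
Proof.
move=> w0 wge0 AU UW.
(* For a nonempty list the head serves as default for [nth]; the sequence is padded with empty sets,
   of weight 0. *)
case: s AU UW => [AU _|z0 s' AU UW].
  rewrite mul0r; apply: le_trans (_ : \sum_(k <oo) w ((fun=> set0) k) <= _).
    by apply: ereal_inf_lbound; exists (fun=> set0) => // x /AU[z].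
  by rewrite eseries0// => i _ _.
set s := z0 :: s' in AU UW *.
pose V k := if (k < size s)%N then U (nth z0 s k) else set0.
apply: le_trans (_ : \sum_(k <oo) w (V k) <= _).
  apply: ereal_inf_lbound; exists V => // x /AU[z zs Uzx].
  exists (index z s) => //; rewrite /V index_mem zs nth_index//.
rewrite (nneseries_split 0%N (size s)); last by move=> k _; exact: wge0.
rewrite add0n [X in _ + X]eseries0 ?adde0; last first.
  by move=> k sk _; rewrite /V ltnNge sk.
rewrite big_mkord; apply: le_trans (_ : \sum_(i < size s) W%:E <= _).
  by apply: lee_sum => i _; rewrite /V ltn_ord UW// mem_nth.
by rewrite sumEFin sumr_const card_ord mulr_natl.
Qed.

Lemma nneseries_le_of_partial (f : nat -> \bar R) (B : \bar R) :
  (forall k, 0 <= f k) -> (forall N, \sum_(0 <= k < N) f k <= B) ->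
  \sum_(k <oo) f k <= B.
Proof.
move=> f0 H; apply: lime_le; first exact: is_cvg_nneseries.
by near=> N; exact: H.
Unshelve. all: by end_near. Qed.

Lemma geometric_nneseries_le (C nu : R) m : (0 <= C)%R -> (0 <= nu)%R -> (nu < 1)%R ->
  \sum_(k <oo) (C * nu ^+ (m + k))%:E <= (C * nu ^+ m / (1 - nu))%:E.
Proof.
move=> C0 nu0 nu1; apply: nneseries_le_of_partial => [k|N].
  by rewrite lee_fin mulr_ge0// exprn_ge0.
rewrite sumEFin lee_fin -mulr_sumr -mulrA ler_wpM2l//.
have nu1' : (0 < 1 - nu)%R by rewrite subr_gt0.
rewrite ler_pdivlMr//.
have -> : ((\sum_(0 <= i < N) nu ^+ (m + i)) * (1 - nu) = nu ^+ m - nu ^+ (m + N))%R.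
  elim: N => [|N IH]; first by rewrite big_geq// mul0r addn0 subrr.
  by rewrite big_nat_recr//= mulrDl IH addnS exprS; ring.
by rewrite gerBl exprn_ge0.
Qed.

Context {n : nat}.
Implicit Types (A U : set 'rV[R]_n) (s : R).

Lemma hausdorff_weight0 s (delta : R) :
  @hausdorff_weight R n s delta set0 = 0.
Proof. by rewrite /hausdorff_weight eqxx. Qed.

Lemma hausdorff_weight_ge0 s (delta : R) U : 0 <= hausdorff_weight s delta U.
Proof.
rewrite /hausdorff_weight; case: ifP => // _; case: ifP => // _.
exact: poweR_ge0.
Qed.

Lemma hausdorff_weight_le s (delta e : R) U : (0 <= s)%R -> (0 <= e)%R -> (e <= delta)%R ->
  (forall x y, U x -> U y -> enorm (x - y) <= e)%R ->
  hausdorff_weight s delta U <= (e `^ s)%:E.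
Proof.
move=> s0 e0 ed Ue; rewrite /hausdorff_weight.
case: ifPn => [_|/set0P[x0 Ux0]]; first by rewrite lee_fin powR_ge0.
have dU : ediam U <= e%:E.
  by apply: ge_ereal_sup => _ [x [y [Ux Uy ->]]]; rewrite lee_fin Ue.
have dU0 : 0 <= ediam U.
  apply: ereal_sup_ubound; exists x0, x0; split => //.
  by rewrite subrr -(scale0r x0) enormZ normr0 mul0r.
rewrite ifT; last by rewrite (le_trans dU)// lee_fin.
have : ediam U \is a fin_num by rewrite ge0_fin_numE// (le_lt_trans dU) ?ltry.
move=> /fineK; case: (ediam U) dU dU0 => // d dU dU0 _.
rewrite poweR_EFin lee_fin; apply: ge0_ler_powR; rewrite ?nnegrE -?lee_fin//.
Qed.

End covers.

Lemma powR_exprn (R : realType) (x r : R) m : 0 <= x -> (x ^+ m) `^ r = (x `^ r) ^+ m.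
Proof.
move=> x0; rewrite -(powR_mulrn m x0) -(powR_mulrn m (powR_ge0 x r)).
exact: powRAC.
Qed.

(** * Bad directions and the Hausdorff measure of the exceptional set *)

Section exceptional_set.
Context {R : realType} {n : nat}.
Variables (p M c a : R) (f : 'rV[R]_n -> 'rV[R]_n) (Df : 'rV[R]_n -> 'M[R]_n).
Variable K : 'rV[R]_n -> \bar R.
Hypotheses (n_gt0 : (0 < n)%N) (p0 : 0 < p) (pn : p^-1 <= n%:R - 1).
Hypothesis fd : finite_distortion f Df K.
Hypothesis KM : (\int[@lebesgue R n]_(x in eball 1%R) poweR (K x) p <= M%:E)%E.
Hypothesis cf : {within @eball R n 1, continuous f}.
Hypotheses (c0 : 0 < c) (a0 : 0 <= a).
Hypothesis growth : forall r : R, 0 < r -> r < 1 ->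
  (\int[@lebesgue R n]_(x in eball r) (jac Df x)%:E <= (c * powR (1 - r) (- a))%:E)%E.

Local Notation epsn := (@eps R n).
Local Notation lamn := (@lam R n).
Local Notation radn := (@rad R n).

Let eps0 : 0 < epsn. Proof. exact: eps_gt0. Qed.
Let lam0 : 0 < lamn. Proof. exact: lam_gt0. Qed.
Let lam1 : lamn < 1. Proof. exact: lam_lt1. Qed.
Let rad0 m : 0 < radn m. Proof. exact: rad_gt0. Qed.

Let natn_gt0 : 0 < n%:R :> R. Proof. by rewrite ltr0n. Qed.

Let M0 : 0 <= M.
Proof.
by rewrite -lee_fin; apply: le_trans KM; apply: integral_ge0 => x _; exact: poweR_ge0.
Qed.

Variable d : R.
Hypothesis d0 : 0 < d.

Definition threshold m : R := radn m `^ (n%:R / p + n%:R * d).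

Definition heavy_point m y : Prop :=
  ((threshold m)%:E <= \int[@lebesgue R n]_(x in cube y (2 * radn m)%R) `|jac Df x|%:E)%E.

(** All centres down to t = 1/2 count, also those far from the sphere compared with [radn m],
    because values at t x are recovered by shrinking the scale at fixed t. The lower bound on t
    keeps the radial projection Lipschitz. *)
Definition bad_direction m : set 'rV[R]_n := [set x | esphere x /\ exists t : R,
  [/\ 2^-1 <= t, t <= 1 - lamn ^+ m.+1 & heavy_point m (t *: x)]].

Lemma cvg_rV (T : Type) (F : set_system T) (FF : Filter F) (h : T -> 'rV[R]_n)
    (l : 'rV[R]_n) :
  (forall j, h x ord0 j @[x --> F] --> l ord0 j) -> h @ F --> l.
Proof.
move=> H; apply/cvg_ballP => e e0.
have : \forall x \near F, forall j, ball (l ord0 j) e (h x ord0 j).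
  apply: filter_forall => j; have /cvg_ballP := H j; exact.
by apply: filterS => x hx; split => // i j; rewrite ord1.
Qed.

(** With r = eps lam^m the factor r^d is eps^d (lam^d)^m. The bound for light cubes is thus the
    hypothesis [flux] of [radial_limit] with mu = lam^d < 1, for each component of f. *)
Lemma radial_limit_of_not_bad x m0 : esphere x ->
  (forall m, (m0 <= m)%N -> ~ bad_direction m x) -> has_radial_limit f x.
Proof.
move=> x1 good.
suff comp j : exists z : R, f (t *: x) ord0 j @[t --> (1 : R)^'-] --> z.
  have [z Hz] := choice comp.
  exists (\row_j z j); apply: cvg_rV => j; rewrite mxE; exact: Hz.
have [u_loc gu] := fd_sobolev fd j.
have g_loc i := (gu i).1; have gu' i := (gu i).2.
apply: (@radial_limit R n n_gt0 (fun y => f y ord0 j) (fun i y => Df y i j) x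
  ((M + 4 ^+ n + 1) * epsn `^ d) (lamn `^ d) m0) => //.
- move=> y Dy; apply: (@continuous_comp _ _ _ f (fun z : 'rV[R]_n => z ord0 j)).
    have := cf; rewrite continuous_open_subspace; last exact: open_eball.
    by apply.
  exact: coord_continuous.
- by rewrite mulr_ge0 ?powR_ge0// addr_ge0// addr_ge0// exprn_ge0.
- exact: powR_ge0.
- by have := @gt0_ltr_powR _ d d0 lamn 1; rewrite !nnegrE powR1; apply => //; exact: ltW.
move=> m t i m0m t2 tm.
have t0 : 0 <= t by apply: le_trans t2; rewrite invr_ge0.
apply: le_trans (@integral_entry_cube_le R n p M f Df K p0 pn fd KM
  (t *: x) (radn m) d i j (rad0 m) _ _) _.
- exact: cube_in_ball.
- rewrite leNgt; apply/negP => H; apply: (good m m0m); split => //.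
  by exists t; split => //; exact: ltW.
rewrite lee_fin -!mulrA ler_wpM2l ?addr_ge0 ?exprn_ge0//.
have rN : radn m != 0 by rewrite gt_eqF.
rewrite powRD ?rN ?implybT// mulrCA le_eqVlt; apply/orP; left; apply/eqP.
congr (_ * _).
  by rewrite -powR_mulrn ?(ltW (rad0 m))// -subn1 natrB.
by rewrite powRM ?exprn_ge0 ?(ltW lam0) ?(ltW eps0)// powR_exprn ?(ltW lam0).
Qed.

Lemma exceptional_subset_bad m0 :
  radial_exceptional_set f `<=` \bigcup_k bad_direction (m0 + k).
Proof.
move=> x [x1 nlim]; apply: contrapT => H; apply: nlim.
apply: (@radial_limit_of_not_bad x m0) => // m m0m bm; apply: H.
by exists (m - m0)%N => //; rewrite subnKC.
Qed.

(** The norms t and t' differ by at most e, so t (x - x') has norm at most 2 e, and t >= 1/2. *)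
Lemma dist_sphere_le (x x' : 'rV[R]_n) (t t' e : R) :
  esphere x -> esphere x' -> 2^-1 <= t -> 2^-1 <= t' ->
  enorm (t *: x - t' *: x') <= e -> enorm (x - x') <= 4 * e.
Proof.
move=> x1 x1' t2 t2' H.
have t0 : 0 <= t by apply: le_trans t2; rewrite invr_ge0.
have t0' : 0 <= t' by apply: le_trans t2'; rewrite invr_ge0.
have h1 : t <= t' + e.
  have := enormD (t *: x - t' *: x') (t' *: x').
  rewrite subrK !enormZ x1 x1' !ger0_norm// !mulr1 => h.
  by apply: le_trans h _; rewrite addrC lerD2l.
have h2 : t' <= t + e.
  have := enormD (t' *: x' - t *: x) (t *: x).
  rewrite subrK !enormZ x1 x1' !ger0_norm// !mulr1 => h.
  by apply: le_trans h _; rewrite addrC lerD2l -enormN opprB.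
have h3 : t * enorm (x - x') <= 2 * e.
  rewrite -{1}(ger0_norm t0) -enormZ.
  have -> : t *: (x - x') = (t *: x - t' *: x') + (t' - t) *: x'.
    by rewrite scalerBr scalerBl addrA subrK.
  apply: le_trans (enormD _ _) _; rewrite enormZ x1' mulr1 mulr2n mulrDl mul1r.
  by apply: lerD => //; rewrite ler_norml; apply/andP; split; lra.
have := enorm_ge0 (x - x'); move: h3; set E := enorm _; nra.
Qed.

(** The cubes about heavy points lie in the ball of radius 1 - 2 n r, where growth bounds the
    Jacobian integral by c (2 n r)^(-a). Divided by the threshold this bounds the length of a
    maximal separated list, and each of its enlarged cubes is projected to the sphere. *)
Lemma cover_bad_direction (s delta : R) m : 0 <= s -> 32 * n%:R * radn m <= delta ->
  (cover_measure (@hausdorff_weight R n s delta) (bad_direction m) <=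
   (c * (2 * n%:R * radn m) `^ (- a) / threshold m * (32 * n%:R * radn m) `^ s)%:E)%E.
Proof.
move=> s0 md.
have r0 := rad0 m.
have tau0 : 0 < threshold m by rewrite powR_gt0.
pose E : set 'rV[R]_n := eball (1 - 2 * n%:R * radn m).
pose Y : set 'rV[R]_n := [set y | exists x, exists t : R, [/\ esphere x, 2^-1 <= t,
  t <= 1 - lamn ^+ m.+1, y = t *: x & heavy_point m y]].
have half0 t : 2^-1 <= t -> (0 : R) <= t.
  by move=> t2; apply: le_trans t2; rewrite invr_ge0.
have nr0 : 0 < 2 * n%:R * radn m by apply: mulr_gt0 => //; rewrite mulr_gt0.
have nr1 : 2 * n%:R * radn m < 1.
  have -> : 2 * n%:R * radn m = lamn ^+ m / 4.
    have := @epsE R n n_gt0; rewrite /rad => E8.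
    transitivity ((8 * n%:R * epsn) * lamn ^+ m / 4); last by rewrite E8 mul1r.
    by field.
  have : lamn ^+ m <= 1 by rewrite exprn_ile1 ?(ltW lam0) ?(ltW lam1).
  lra.
have mE : measurable E by exact/open_measurable_rV/open_eball.
have ED : E `<=` eball 1 by apply: eball_sub; rewrite gerBl ltW.
have mJ : measurable_fun E (fun x => `|jac Df x|).
  have [mJ _] := fd_jacobian fd; apply: measurableT_comp => //.
  apply: measurable_funS mJ => //; exact/open_measurable_rV/open_eball.
have YE y : Y y -> cube y (2 * radn m) `<=` E.
  by move=> [x [t [x1 t2 tm -> _]]] z; apply: cube_in_eball => //; exact: half0.
have heavyY y : Y y ->
    ((threshold m)%:E <= \int[@lebesgue R n]_(x in cube y (2 * radn m)%R) `|jac Df x|%:E)%E.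
  by move=> [x [t [_ _ _ _]]].
have total : (\int[@lebesgue R n]_(x in E) `|jac Df x|%:E <=
    (c * (2 * n%:R * radn m) `^ (- a))%:E)%E.
  rewrite (integral_jac fd); last by rewrite gerBl ltW.
  have := @growth (1 - 2 * n%:R * radn m); rewrite subr_gt0 => /(_ nr1).
  by rewrite gtrBl nr0 => /(_ isT); rewrite opprB addrCA subrr addr0.
have [sq [sqT sqY sqcov]] := maximal_separated mE mJ
  (fun x => normr_ge0 _) YE tau0 heavyY total.
pose U (z : 'rV[R]_n) : set 'rV[R]_n := [set x | esphere x /\
  exists t : R, 2^-1 <= t /\ cube z (4 * radn m) (t *: x)].
apply: le_trans (@cover_measure_le_seq _ _ _ _ _ sq U ((32 * n%:R * radn m) `^ s) _ _ _ _) _.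
- exact: hausdorff_weight0.
- exact: hausdorff_weight_ge0.
- move=> x [x1 [t [t2 tm hp]]].
  have [|z zs zc] := sqcov (t *: x); first by exists x, t.
  by exists z => //; split => //; exists t.
- move=> z _; apply: hausdorff_weight_le => //.
    by apply: mulr_ge0; [rewrite mulr_ge0|exact: ltW].
  move=> x x' [x1 [t [t2 /cubeP xz]]] [x1' [t' [t2' /cubeP xz']]].
  (* Coordinates in a cube of half-side 4 r differ by at most 8 r; the factor n passes to the
     Euclidean norm and the factor 4 is that of [dist_sphere_le]. *)
  have -> : 32 * n%:R * radn m = 4 * (n%:R * (8 * radn m)) by ring.
  apply: (dist_sphere_le x1 x1' t2 t2'); apply: enorm_le_coord => i.
  have := xz i; have := xz' i; rewrite !mxE !ler_norml => /andP[h1 h2] /andP[h3 h4].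
  by apply/andP; split; lra.
rewrite lee_fin; apply: ler_wpM2r; first exact: powR_ge0.
by rewrite ler_pdivlMr.
Qed.

Lemma hausdorff_measure_null (s : R) : a + n%:R / p + n%:R * d < s ->
  hausdorff_measure s (radial_exceptional_set f) = 0%E.
Proof.
move=> s_gt.
have s0 : 0 <= s.
  apply: le_trans (ltW s_gt); rewrite !addr_ge0 ?mulr_ge0 ?invr_ge0//; exact: ltW.
(* The surplus exponent: the cover at scale m contributes a constant times (radn m)^sg, which is
   geometric in m with ratio nu = lam^sg < 1. *)
pose sg := s - (a + n%:R / p + n%:R * d).
have sg0 : 0 < sg by rewrite subr_gt0.
pose nu := lamn `^ sg.
have nu0 : 0 <= nu by exact: powR_ge0.
have nu1 : nu < 1.
  by have := @gt0_ltr_powR _ sg sg0 lamn 1; rewrite !nnegrE powR1; apply => //; exact: ltW.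
pose C := c * (2 * n%:R) `^ (- a) * (32 * n%:R) `^ s * epsn `^ sg.
have C0 : 0 <= C by rewrite !mulr_ge0 ?powR_ge0// ltW.
have CE m : c * (2 * n%:R * radn m) `^ (- a) / threshold m * (32 * n%:R * radn m) `^ s =
    C * nu ^+ m.
  have rN : radn m != 0 by rewrite gt_eqF.
  have -> : C * nu ^+ m = c * (2 * n%:R) `^ (- a) * (32 * n%:R) `^ s * radn m `^ sg.
    rewrite /C -mulrA; congr (_ * _).
    rewrite [RHS](powRM _ (ltW eps0) (exprn_ge0 m (ltW lam0))).
    by rewrite powR_exprn ?(ltW lam0).
  have n2 : 0 <= 2 * n%:R :> R by rewrite mulr_ge0.
  have n32 : 0 <= 32 * n%:R :> R by rewrite mulr_ge0.
  rewrite /threshold -powRN (powRM _ n2 (ltW (rad0 m))).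
  rewrite (powRM _ n32 (ltW (rad0 m))).
  have -> : radn m `^ sg = radn m `^ (- a) * radn m `^ (- (n%:R / p + n%:R * d)) * radn m `^ s.
    by rewrite -!powRD ?rN ?implybT//; congr powR; rewrite /sg; ring.
  ring.
apply/eqP; rewrite eq_le; apply/andP; split; last first.
  apply: ereal_sup_ge; exists (cover_measure (@hausdorff_weight R n s 1)
    (radial_exceptional_set f)); first by exists 1 => //=; exact: ltr01.
  apply: cover_measure_ge0; exact: hausdorff_weight_ge0.
apply: ge_ereal_sup => _ [delta /= delta0 <-].
set W := hausdorff_weight s delta.
have Wge0 B : (0 <= W B)%E by exact: hausdorff_weight_ge0.
apply/lee_addgt0Pr => e e0; rewrite add0e.
have nu1' : 0 < 1 - nu by rewrite subr_gt0.
(* Beyond N1 the diameters are at most delta; beyond N2 the tail of the geometric series is at most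
   e. The divisor C + 1 avoids the case C = 0. *)
have [N1 HN1] := @rad_small R n n_gt0 (delta / (32 * n%:R))
  ltac:(by rewrite divr_gt0// mulr_gt0).
have [N2 HN2] := @small_expr R nu (e * (1 - nu) / (C + 1)) nu0 nu1
  ltac:(by rewrite divr_gt0 ?mulr_gt0//; lra).
pose m0 := maxn N1 N2.
apply: le_trans (_ : cover_measure W (\bigcup_k bad_direction (m0 + k)) <= _)%E.
  by apply: le_cover_measure => //; exact: exceptional_subset_bad.
have subadd := cover_measure_sigma_subadditive Wge0 (fun k => bad_direction (m0 + k)).
apply: le_trans subadd _.
apply: le_trans (_ : \sum_(k <oo) (C * nu ^+ (m0 + k))%:E <= _)%E.
  apply: lee_nneseries => [k _ _|k _]; first exact: cover_measure_ge0.
  rewrite -CE; apply: cover_bad_direction => //.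
  rewrite mulrC -ler_pdivlMr ?mulr_gt0// ltW// HN1//.
  by rewrite (leq_trans (leq_maxl N1 N2))// leq_addr.
apply: le_trans (geometric_nneseries_le m0 C0 nu0 nu1) _.
rewrite lee_fin ler_pdivrMr//.
have := HN2 m0 (leq_maxr _ _); rewrite ltr_pdivlMr; last by lra.
have : 0 <= nu ^+ m0 by rewrite exprn_ge0.
move: C0; set X := nu ^+ m0; set Z := e * _; nra.
Qed.

End exceptional_set.

Theorem theorem5p1 (R : realType) (n : nat) (p : R)
    (f : 'rV[R]_n -> 'rV[R]_n) (Df : 'rV[R]_n -> 'M[R]_n)
    (K : 'rV[R]_n -> \bar R) (c a : R) :
  (3 <= n)%N ->
  n%:R - 1 < p ->
  {within @eball R n 1, continuous f} ->
  p_integrable_distortion p f Df K ->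
  0 < c ->
  0 <= a ->
  a < n%:R - 1 - n%:R / p ->
  (forall r : R, 0 < r -> r < 1 ->
    (\int[@lebesgue R n]_(x in eball r) (jac Df x)%:E
     <= (c * powR (1 - r) (- a))%:E)%E) ->
  (hausdorff_dim (radial_exceptional_set f) <= (a + n%:R / p)%:E)%E /\
  surface_measure (radial_exceptional_set f) = 0%E.
Proof.
move=> n3 np cf [fd [M KM]] c0 a0 an growth.
have n_gt0 : (0 < n)%N by exact: leq_trans n3.
have n3R : 3 <= n%:R :> R by rewrite ler_nat.
have p0 : 0 < p by lra.
have pn : p^-1 <= n%:R - 1.
  by apply: le_trans (_ : 1 <= _); [rewrite invf_le1//; lra|lra].
have np0 : 0 <= n%:R / p by rewrite divr_ge0// ltW.
have null s : a + n%:R / p < s -> hausdorff_measure s (radial_exceptional_set f) = 0%E.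
  (* With this d, the exponent a + n/p + n d lies halfway between a + n/p and s. *)
  move=> s_gt; pose d := (s - (a + n%:R / p)) / (2 * n%:R).
  have d0 : 0 < d by rewrite divr_gt0 ?subr_gt0// mulr_gt0//; lra.
  apply: (@hausdorff_measure_null R n p M c a f Df K n_gt0 p0 pn fd KM cf c0 a0 growth d d0).
  have -> : n%:R * d = (s - (a + n%:R / p)) / 2.
    by rewrite /d; field; rewrite gt_eqF//; lra.
  lra.
split; last first.
  (* The upper bound on a says that n - 1 itself exceeds a + n/p, so the set is null for the
     Hausdorff measure of dimension n - 1. *)
  rewrite /surface_measure null ?mule0//.
  by rewrite -subn1 natrB//; lra.
apply/lee_addgt0Pr => e e0.
apply: ereal_inf_lbound; exists (a + n%:R / p + e) => //.
split; first by rewrite !addr_ge0// ltW.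
by apply: null; rewrite ltrDl.
Qed.
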